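(* Let $D\in\mathbb{N}$ and let $\Xi_{\mathsf{H}_D}$ be the Heisenberg determinantal point process on $\mathbb{C}^D$ (defined in the context). For $R>0$ let $\mathbb{B}^{(2D)}_R=\{x\in\mathbb{C}^D:|x|<R\}$. Then $\Xi_{\mathsf{H}_D}$ is hyperuniform of Class I, i.e. $\mathrm{Var}[\Xi_{\mathsf{H}_D}(\mathbb{B}^{(2D)}_R)] \asymp R^{2D-1}$ as $R\to\infty$ (there exist constants $0<c_1<c_2<\infty$ with $c_1R^{2D-1}<\mathrm{Var}[\Xi_{\mathsf{H}_D}(\mathbb{B}^{(2D)}_R)]<c_2R^{2D-1}$ for all large $R$), and more precisely \[ \lim_{R\to\infty} R\,\frac{\mathrm{Var}[\Xi_{\mathsf{H}_D}(\mathbb{B}^{(2D)}_R)]}{\mathbb{E}[\Xi_{\mathsf{H}_D}(\mathbb{B}^{(2D)}_R)]}=\frac{D}{\sqrt{\pi}}. \] Moreover, the following asymptotic expansion holds as $R\to\infty$: \[ \frac{\mathrm{Var}[\Xi_{\mathsf{H}_D}(\mathbb{B}^{(2D)}_R)]}{\mathbb{E}[\Xi_{\mathsf{H}_D}(\mathbb{B}^{(2D)}_R)]} \sim \frac{D}{\sqrt{\pi}} R^{-1}\sum_{k=0}^{\infty}(-1)^k\frac{\alpha_k(D)}{(2k+1)\,k!\,2^{4k}}R^{-2k}, \] where $\alpha_0(D)=1$ and $\alpha_k(D)=\prod_{\ell=1}^k\{4D^2-(2\ell-1)^2\}=\prod_{\ell=-k+1}^{k}(2D+2\ell-1)$ for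 $k\in\mathbb{N}$.
   Context: For $x, y \in \mathbb{C}^D$, $x\cdot\overline{y}=\sum_{\ell=1}^D x^{(\ell)}\overline{y^{(\ell)}}$ and $|x|=\sqrt{x\cdot\overline{x}}$. A simple point process $\Xi$ on $S$ with reference measure $\lambda$ is a determinantal point process (DPP) with correlation kernel $K$ if for every $n$ its $n$-th correlation function with respect to $\lambda^{\otimes n}$ is $\det_{1\le i,j\le n}[K(x_i,x_j)]$. The Heisenberg DPP $\Xi_{\mathsf{H}_D}$ is the DPP on $\mathbb{C}^D$ with kernel $K_{\mathsf{H}_D}(x,y)=e^{x\cdot\overline{y}}$ with respect to $\lambda(dx)=\pi^{-D}e^{-|x|^2}dx$ ($dx$ Lebesgue measure on $\mathbb{C}^D\simeq\mathbb{R}^{2D}$). $\Xi(\Lambda)$ denotes the number of points in $\Lambda$. The asymptotic expansion $f(R)\sim R^{-1}\sum_k a_kR^{-2k}$ is meant in the Poincaré sense: for each $N$, $f(R)-R^{-1}\sum_{k=0}^{N}a_kR^{-2k}=O(R^{-2N-3})$. *)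

(* Defs.v *)
From HB Require Import structures.
From mathcomp Require Import all_boot all_order all_algebra.
From mathcomp Require Import all_classical all_reals all_analysis measurable_realfun.
From mathcomp.real_closed Require Import complex.

Set Implicit Arguments.
Unset Strict Implicit.
Unset Printing Implicit Defensive.

Import Order.TTheory GRing.Theory Num.Theory.
Import numFieldNormedType.Exports.

Local Open Scope classical_set_scope.
Local Open Scope ring_scope.

(* The space C^D.  A point x of C^D is a D-tuple of pairs (Re x_l, Im x_l);  *)
(* it carries the product (Borel) sigma-algebra of R^{2D}.                   *)
Definition CD (R : realType) (D : nat) := D.-tuple (R * R).

Definition coord (R : realType) (D : nat) (x : CD R D) (l : 'I_D) : R[i] :=
  ((tnth x l).1 +i* (tnth x l).2)%C.

Definition cdot (R : realType) (D : nat) (x y : CD R D) : R[i] :=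
  \sum_(l < D) coord x l * (coord y l)^*.

Definition cnorm (R : realType) (D : nat) (x : CD R D) : R :=
  Num.sqrt (\sum_(l < D) ((tnth x l).1 ^+ 2 + (tnth x l).2 ^+ 2)).

Definition expC (R : realType) (z : R[i]) : R[i] :=
  ((expR (complex.Re z) * cos (complex.Im z)) +i*
   (expR (complex.Re z) * sin (complex.Im z)))%C.

Definition KH (R : realType) (D : nat) (x y : CD R D) : R[i] := expC (cdot x y).

Definition lambda_density (R : realType) (D : nat) (x : CD R D) : R :=
  (pi ^+ D)^-1 * expR (- (cnorm x ^+ 2)).

Definition ballC (R : realType) (D : nat) (r : R) : set (CD R D) :=
  [set x | cnorm x < r].
Arguments ballC {R} D r.

(* Lebesgue integration on C ~ R^2, C^D ~ R^{2D} and (C^D)^n, as iterated   *)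
(* Lebesgue integrals (for the nonnegative measurable integrands used below *)
(* this is the integral against the product Lebesgue measure, by Tonelli).  *)
Fixpoint iter_int (R : realType) (T : Type) (I : (T -> \bar R) -> \bar R) (n : nat)
  : (n.-tuple T -> \bar R) -> \bar R :=
  match n return (n.-tuple T -> \bar R) -> \bar R with
  | 0 => fun f => f [tuple]
  | n'.+1 => fun f => I (fun x => @iter_int R T I n' (fun t => f [tuple of x :: t]))
  end.

Definition leb_int_C (R : realType) (f : R * R -> \bar R) : \bar R :=
  (\int[@lebesgue_measure R]_a \int[@lebesgue_measure R]_b f (a, b))%E.

Definition leb_int_CD (R : realType) (D : nat) : (CD R D -> \bar R) -> \bar R :=
  @iter_int R (R * R) (@leb_int_C R) D.

Definition leb_int_CDn (R : realType) (D n : nat)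
  : (n.-tuple (CD R D) -> \bar R) -> \bar R :=
  @iter_int R (CD R D) (@leb_int_CD R D) n.
Arguments leb_int_CDn {R} D n.
Arguments leb_int_CD {R} D.

(* Point processes on C^D.  A point process on a probability space           *)
(* (Omega, P) is a random configuration Xi : Omega -> set (C^D) (a set, so   *)
(* the process is simple) which is locally finite and whose counting         *)
(* variables Xi(A) are measurable for every Borel set A.                     *)

Definition npoints (R : realType) (D : nat) (X : set (CD R D)) (A : set (CD R D))
  : \bar R :=
  (\esum_(x in X `&` A) 1)%E.

Definition is_simple_point_process (R : realType) (D : nat)
  (d : measure_display) (Omega : measurableType d) (Xi : Omega -> set (CD R D)) :=
  (forall w r, finite_set (Xi w `&` ballC D r)) /\
  (forall A : set (CD R D), measurable A ->
     measurable_fun setT (fun w => npoints (Xi w) A)).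

(* Determinantal point process with kernel K w.r.t. lambda(dx) = pi^{-D}e^{-|x|^2}dx:
   for every n, the n-th correlation function w.r.t. lambda^{(x)n} is
   det[K(x_i,x_j)], i.e. (Hough-Krishnapur-Peres-Virag) for all mutually
   disjoint Borel sets A_1..A_n,
     E[ prod_i Xi(A_i) ] = int_{A_1 x..x A_n} det[K(x_i,x_j)] lambda^{(x)n}(dx).
   (det[K(x_i,x_j)] is real for the Hermitian kernels considered; we take its
   real part to integrate it as a real function.) *)
Definition is_DPP (R : realType) (D : nat)
  (d : measure_display) (Omega : measurableType d) (P : probability Omega R)
  (Xi : Omega -> set (CD R D)) (K : CD R D -> CD R D -> R[i]) :=
  is_simple_point_process Xi /\
  forall (n : nat) (A : 'I_n -> set (CD R D)),
    (forall i, measurable (A i)) ->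
    (forall i j, i != j -> A i `&` A j = set0) ->
    (\int[P]_w (\prod_(i < n) npoints (Xi w) (A i)))%E =
    leb_int_CDn D n (fun xs : n.-tuple (CD R D) =>
      ((\1_[set xs' : n.-tuple (CD R D) | forall i, A i (tnth xs' i)] xs) *
       complex.Re (\det (\matrix_(i < n, j < n) K (tnth xs i) (tnth xs j))) *
       \prod_(i < n) lambda_density (tnth xs i))%:E).

(* Expectation and variance of the number of points Xi(A) (real numbers;
   they are finite for the process considered). *)
Definition mean_count (R : realType) (D : nat)
  (d : measure_display) (Omega : measurableType d) (P : probability Omega R)
  (Xi : Omega -> set (CD R D)) (A : set (CD R D)) : R :=
  fine (\int[P]_w npoints (Xi w) A)%E.

Definition var_count (R : realType) (D : nat)
  (d : measure_display) (Omega : measurableType d) (P : probability Omega R)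
  (Xi : Omega -> set (CD R D)) (A : set (CD R D)) : R :=
  fine (\int[P]_w ((npoints (Xi w) A - (mean_count P Xi A)%:E) ^+ 2))%E.

Definition alpha (R : realType) (k D : nat) : R :=
  \prod_(1 <= l < k.+1) (4 * (D%:R) ^+ 2 - ((2 * l)%:R - 1) ^+ 2).

(* coefficient of R^{-1-2k} in the expansion (without the factor D/sqrt pi) *)
Definition expansion_coef (R : realType) (k D : nat) : R :=
  (-1) ^+ k * alpha R k D / ((2 * k + 1)%:R * (k`!)%:R * 2 ^+ (4 * k)).

(* Main.v *)
Require Import Defs.
From HB Require Import structures.
From mathcomp Require Import all_boot all_order all_algebra.
From mathcomp Require Import all_classical all_reals all_analysis measurable_realfun.
From mathcomp Require Import ring lra.
From mathcomp.real_closed Require Import complex.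
Import Order.TTheory GRing.Theory Num.Theory.
Import numFieldNormedType.Exports.
Set Implicit Arguments.
Unset Strict Implicit.
Unset Printing Implicit Defensive.
Local Open Scope classical_set_scope.
Local Open Scope ring_scope.

(* Writing N for the number of points in the ball B of radius r, the one- and
   two-point intensities give E N = pi^-D vol(B) and
     Var N = pi^-D vol(B) - pi^-2D int_B int_B e^{-|x-y|^2} dx dy;
   correlations are only known on disjoint sets, so E[N(N-1)] is obtained by
   cutting B into the cells of ever finer finite partitions, using that the
   two-point intensity vanishes on the diagonal.  Substituting y = x + u, the
   double integral is that of e^{-|u|^2} vol(B cap (B - u)), and the missing
   volume vol(B) - vol(B cap (B - u)) is the volume of a slab of B of width |u|
   orthogonal to u.  Exchanging integrals, Var N is, up to a constant,
     int_{t>0} (r^2 - t^2)_+^{D-1/2} P(Gamma_D > 4 t^2) dt.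
   The Taylor expansion of (1 - x)_+^{D-1/2}, whose remainder is O(x^N) uniformly
   for x >= 0, together with the moments of the Gamma tail gives the asymptotic
   expansion, and its first term gives the limit and the Class I bounds. *)

(** * Iterated integrals of nonnegative functions *)

(** The correlations are prescribed as iterated integrals; each is first represented by a
    sigma-finite measure ([mu_CD] on C^D), so that Tonelli applies between whole blocks of
    variables. Rotation invariance of C^D is obtained from planar rotations alone. An integrand that
    depends on $|p|^2$ and one real linear form reduces to two real coordinates, plus one positive
    variable $|z|^2$ with a factor $\pi$ for each remaining complex coordinate. With $n=D-1$, the
    volume constant [slice_vol n 1] (unit ball of dimension $2D-1$) and $\Gamma(D+1/2)$ are never
    evaluated: only their product enters, and a Gaussian integral shows it to be $\sqrt\pi$. This
    gives $D/\sqrt\pi$; the numbers $\alpha_k(D)$ arise by pairing the factors of the binomial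
    coefficients of $(1-x)^{D-1/2}$ with those of $\Gamma(D+k+1/2)/\Gamma(D+1/2)$. *)

Definition ind {R : realType} (b : bool) : \bar R := (b%:R)%:E.

Section Measurability.
Context d (T : measurableType d) (R : realType).

Lemma ind_ge0 b : (0 <= @ind R b)%E.
Proof. by rewrite lee_fin ler0n. Qed.

(** The second factor need only be nonnegative where the indicator is 1: powers such as $(q-v)^m$
    may be negative elsewhere. *)
Lemma ind_mule_ge0 (b : bool) (x : \bar R) : (b -> 0 <= x)%E -> (0 <= ind b * x)%E.
Proof. by case: b => [/(_ isT)|_]; rewrite /ind ?mul1e ?mul0e. Qed.

Lemma ind_and a b : (@ind R (a && b) = ind a * ind b)%E.
Proof. by case: a b => [] []; rewrite /ind -EFinM ?mulr1 ?mulr0. Qed.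

Lemma measurable_ind (f : T -> bool) :
  measurable_fun setT f -> measurable_fun setT (fun x => @ind R (f x)).
Proof.
by move=> mf; apply: (@measurableT_comp _ _ _ _ _ _ (@ind R) setT f).
Qed.

Lemma measurable_EFin_comp (f : T -> R) :
  measurable_fun setT f -> measurable_fun setT (fun x => (f x)%:E).
Proof. by move=> mf; apply/measurable_EFinP. Qed.

Lemma measurable_sqrt_comp (f : T -> R) :
  measurable_fun setT f -> measurable_fun setT (fun x => Num.sqrt (f x)).
Proof.
move=> mf; apply: (@measurableT_comp _ _ _ _ _ _ (@Num.sqrt R) setT f) => //.
apply: continuous_measurable_fun; exact: sqrt_continuous.
Qed.

Lemma measurable_expR_comp (f : T -> R) :
  measurable_fun setT f -> measurable_fun setT (fun x => expR (f x)).
Proof. by move=> mf; apply: (@measurableT_comp _ _ _ _ _ _ (@expR R) setT f). Qed.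

Lemma measurable_norm_comp (f : T -> R) :
  measurable_fun setT f -> measurable_fun setT (fun x => `|f x|).
Proof.
by move=> mf; apply: (@measurableT_comp _ _ _ _ _ _ (@Num.norm R R) setT f).
Qed.

Lemma measurable_opp_comp (f : T -> R) :
  measurable_fun setT f -> measurable_fun setT (fun x => - f x).
Proof. by move=> mf; exact: measurable_funN. Qed.

Lemma measurable_fst_comp d1 d2 (T1 : measurableType d1) (T2 : measurableType d2)
  (f : T -> T1 * T2) :
  measurable_fun setT f -> measurable_fun setT (fun x => (f x).1).
Proof. by move=> mf; apply: (@measurableT_comp _ _ _ _ _ _ fst setT f). Qed.

Lemma measurable_snd_comp d1 d2 (T1 : measurableType d1) (T2 : measurableType d2)
  (f : T -> T1 * T2) :
  measurable_fun setT f -> measurable_fun setT (fun x => (f x).2).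
Proof. by move=> mf; apply: (@measurableT_comp _ _ _ _ _ _ snd setT f). Qed.

Lemma measurable_tnth_comp d1 (T1 : measurableType d1) n (i : 'I_n)
  (f : T -> n.-tuple T1) :
  measurable_fun setT f -> measurable_fun setT (fun x => tnth (f x) i).
Proof.
move=> mf; apply: (@measurableT_comp _ _ _ _ _ _ (fun x => tnth x i) setT f) => //.
exact: measurable_tnth.
Qed.

Lemma measurable_real_sum (I : Type) (s : seq I) (h : I -> T -> R) :
  (forall i, measurable_fun setT (h i)) ->
  measurable_fun setT (fun x => \sum_(i <- s) h i x).
Proof.
move=> mh; elim: s => [|i s IH].
  under eq_fun do rewrite big_nil; exact: measurable_cst.
under eq_fun do rewrite big_cons; exact: measurable_funD.
Qed.

Lemma measurable_section_int d2 (T2 : measurableType d2)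
  (m : {sigma_finite_measure set T2 -> \bar R}) (f : T -> T2 -> \bar R) :
  measurable_fun setT (fun z : T * T2 => f z.1 z.2) ->
  (forall x y, 0 <= f x y)%E ->
  measurable_fun setT (fun x => \int[m]_y f x y)%E.
Proof.
move=> mf f0.
exact: (@measurable_fun_fubini_tonelli_F _ _ _ _ _ m (fun z => f z.1 z.2)).
Qed.

Lemma measurable_comp2 d1 d2 d3 (T1 : measurableType d1) (T2 : measurableType d2)
  (T3 : measurableType d3) (F : T1 -> T2 -> T3) (a : T -> T1) (b : T -> T2) :
  measurable_fun setT (fun z : T1 * T2 => F z.1 z.2) ->
  measurable_fun setT a -> measurable_fun setT b ->
  measurable_fun setT (fun x => F (a x) (b x)).
Proof.
move=> mF ma mb.
exact: (@measurableT_comp _ _ _ _ _ _ (fun z : T1 * T2 => F z.1 z.2) setT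
  (fun x => (a x, b x)) mF (measurable_fun_pair ma mb)).
Qed.

End Measurability.

(* Hook of measT, redefined below each time new measurable functions appear. *)
Ltac measT_ext := fail.

Ltac measT :=
  lazymatch goal with
  | |- forall _, _ => intro; measT
  | |- measurable_fun _ (fun _ => ?c) => exact: measurable_cst
  | |- measurable_fun _ (fun x => x) => exact: measurable_id
  | |- measurable_fun _ (fun x => _ + _)%R => apply: measurable_funD; measT
  | |- measurable_fun _ (fun x => _ * _)%R => apply: measurable_funM; measT
  | |- measurable_fun _ (fun x => - _)%R => apply: measurable_opp_comp; measT
  | |- measurable_fun _ (fun x => _ ^+ _)%R => apply: measurable_funX; measT
  | |- measurable_fun _ (fun x => Num.sqrt _) => apply: measurable_sqrt_comp; measT
  | |- measurable_fun _ (fun x => expR _) => apply: measurable_expR_comp; measT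
  | |- measurable_fun _ (fun x => `| _ |%R) => apply: measurable_norm_comp; measT
  | |- measurable_fun _ (fun x => ind _) => apply: measurable_ind; measT
  | |- measurable_fun _ (fun x => EFin _) => apply: measurable_EFin_comp; measT
  | |- measurable_fun _ (fun x => Order.lt _ _) => apply: measurable_fun_ltr; measT
  | |- measurable_fun _ (fun x => Order.le _ _) => apply: measurable_fun_ler; measT
  | |- measurable_fun _ (fun x => andb _ _) => apply: measurable_and; measT
  | |- measurable_fun _ (fun x => (_ + _)%E) => apply: emeasurable_funD; measT
  | |- measurable_fun _ (fun x => (_ * _)%E) => apply: emeasurable_funM; measT
  | |- measurable_fun _ (fun x => pair _ _) => apply: measurable_fun_pair; measT
  | |- measurable_fun _ (fun x => tuple _) => apply: measurable_cons; measT
  | |- measurable_fun _ (fun x => cons_tuple _ _) => apply: measurable_cons; measT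
  | |- measurable_fun _ (fun x => fst _) => apply: measurable_fst_comp; measT
  | |- measurable_fun _ (fun x => snd _) => apply: measurable_snd_comp; measT
  | |- measurable_fun _ (fun x => tnth _ _) => apply: measurable_tnth_comp; measT
  | |- measurable_fun _ (fun x => \sum_(i <- _) _)%R => apply: measurable_real_sum; measT
  | |- measurable_fun _ (fun x => integral _ setT _) =>
      apply: measurable_section_int; [measT|]
  | H : measurable_fun _ (fun z => ?F z.1 z.2) |- measurable_fun _ (fun x => ?F _ _) =>
      apply: (measurable_comp2 H); measT
  | H : measurable_fun _ ?F |- measurable_fun _ (fun x => ?F _) =>
      apply: (measurableT_comp H); measT
  | |- measurable_fun _ (fun _ => _) => first [measT_ext | assumption | idtac]
  | |- measurable_fun ?D ?g =>
      first [assumption | change (measurable_fun D (fun x => g x)); measT]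
  | _ => idtac
  end.

Ltac nnT_ext := fail.

Ltac nnT :=
  lazymatch goal with
  | |- forall _, _ => intro; nnT
  | |- is_true (Order.le _ (ind _)) => exact: ind_ge0
  | |- is_true (Order.le _ (integral _ _ _)) => apply: integral_ge0; intros; nnT
  | |- is_true (Order.le _ (ind _ * _)%E) =>
      apply: ind_mule_ge0; intros;
      repeat match goal with H : is_true (_ && _) |- _ => move/andP: H => [? ?] end;
      nnT
  | |- is_true (Order.le _ (_ * _)%E) => apply: mule_ge0; nnT
  | |- is_true (Order.le _ (_ + _)%E) => apply: adde_ge0; nnT
  | |- is_true (Order.le _ (EFin _)) => rewrite lee_fin; nnT
  | |- is_true (Order.le _ (expR _)) => exact: expR_ge0
  | |- is_true (Order.le _ (Num.sqrt _)) => exact: sqrtr_ge0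
  | |- is_true (Order.le _ (_ * _)%R) => apply: mulr_ge0; nnT
  | |- is_true (Order.le _ (_ - _)%R) => rewrite subr_ge0; nnT
  | |- is_true (Order.le _ (_ + _)%R) => apply: addr_ge0; nnT
  | |- is_true (Order.le _ (_ ^+ _)%R) => apply: exprn_ge0; nnT
  | |- is_true (Order.le _ (_ ^-1)%R) => rewrite invr_ge0; nnT
  | |- is_true (Order.le _ (_ %:R)%R) => exact: ler0n
  | |- is_true (Order.le _ (@pi _)) => exact: pi_ge0
  | |- is_true (Order.le _ `| _ |%R) => exact: normr_ge0
  | H : is_true (Order.lt _ ?x) |- is_true (Order.le _ ?x) => exact: (ltW H)
  | H : forall _, is_true (Order.le _ (?f _)) |- is_true (Order.le _ (?f _)) => exact: H
  | H : forall _ _, is_true (Order.le _ (?f _ _)) |- is_true (Order.le _ (?f _ _)) => exact: H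
  | _ => first [nnT_ext | assumption | exact: lexx | exact: ler01 | exact: lee01 | idtac]
  end.

Ltac sideT :=
  lazymatch goal with
  | |- measurable_fun _ _ => measT; try sideT
  | |- forall _, _ => intro; sideT
  | _ => nnT
  end.

(** * Changes of variables on the line *)

Section PushMeasure.
Context d1 d2 (T1 : measurableType d1) (T2 : measurableType d2) (R : realType).
Variables (m : {measure set T1 -> \bar R}) (phi : T1 -> T2).
Hypothesis mphi : measurable_fun setT phi.

Definition push_measure : {measure set T2 -> \bar R} :=
  measure_function_pushforward__canonical__measure_function_Measure m mphi.

Lemma push_measureE A : push_measure A = m (phi @^-1` A).
Proof. by []. Qed.

Lemma integral_push (f : T2 -> \bar R) : measurable_fun setT f ->
  (forall x, 0 <= f x)%E ->
  (\int[push_measure]_y f y = \int[m]_x f (phi x))%E.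
Proof. by move=> mf f0; rewrite ge0_integral_pushforward. Qed.

End PushMeasure.

Notation "'\intR_' x f" := (integral (@lebesgue_measure _) setT (fun x => f))
  (at level 36, x name, f at level 36) : ereal_scope.

Section Lebesgue1D.
Context {R : realType}.
Local Open Scope ereal_scope.
Implicit Types f : R -> \bar R.

Lemma intR_ge0 f : (forall x, 0 <= f x) -> 0 <= \intR_ x f x.
Proof. by move=> f0; apply: integral_ge0. Qed.

Lemma eq_intR f g : f =1 g -> \intR_ x f x = \intR_ x g x.
Proof. by move=> fg; apply: eq_integral => x _. Qed.

(** Lebesgue measure is determined by its values on half-open intervals, and its translate takes the
    same values there. *)
Lemma intR_shift f (c : R) : measurable_fun setT f -> (forall x, 0 <= f x) ->
  \intR_ x f (x + c)%R = \intR_ x f x.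
Proof.
move=> mf f0.
pose phi : R -> measurableTypeR R := fun x => (x + c)%R.
have mphi : measurable_fun setT phi by rewrite /phi; measT.
rewrite -(integral_push (@lebesgue_measure R) mphi mf f0).
apply: eq_measure_integral => A mA _.
apply/esym/lebesgue_measure_unique => //= _ [[a b]] _ <-.
transitivity ((@lebesgue_measure R) `](a - c)%R, (b - c)%R]%classic); last first.
  congr lebesgue_measure.
  by apply/seteqP; split => x /=; rewrite /phi !in_itv/= ltrBlDr lerBrDr.
rewrite !lebesgue_measure_itv/= !lte_fin ltrD2r -!EFinB.
by rewrite (_ : b - c - (a - c) = b - a)%R//; ring.
Qed.

Lemma intR_scale f (k : R) : (0 < k)%R -> measurable_fun setT f ->
  (forall x, 0 <= f x) ->
  \intR_ x f x = k%:E * \intR_ x f (k * x)%R.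
Proof.
move=> k0 mf f0.
pose phi : R -> measurableTypeR R := fun x => (k * x)%R.
have mphi : measurable_fun setT phi by rewrite /phi; measT.
pose kp : {nonneg R} := NngNum (ltW k0).
rewrite -(integral_push (@lebesgue_measure R) mphi mf f0).
rewrite -[k in k%:E]/(kp%:num) -ge0_integral_mscale//.
apply: eq_measure_integral => A mA _.
apply: lebesgue_measure_unique => //= _ [[a b]] _ <-.
transitivity (k%:E * (@lebesgue_measure R) `](a / k)%R, (b / k)%R]%classic); last first.
  congr (_ * lebesgue_measure _).
  by apply/seteqP; split => x /=; rewrite /phi !in_itv/= ltr_pdivrMr// ler_pdivlMr// mulrC.
rewrite !lebesgue_measure_itv/= !lte_fin ltr_pM2r ?invr_gt0//.
case: ifP => _; last by rewrite mule0.
by rewrite -!EFinB -EFinM -mulrBl mulrC divfK// gt_eqF.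
Qed.

Lemma intR_opp f : measurable_fun setT f -> (forall x, 0 <= f x) ->
  \intR_ x f (- x)%R = \intR_ x f x.
Proof.
move=> mf f0.
transitivity (\int[pushforward (@lebesgue_measure R) (-%R : _ -> measurableTypeR R)]_x f x).
  by rewrite ge0_integral_pushforward.
by apply: eq_measure_integral => A mA _; exact: lebesgue_measureN.
Qed.

Lemma intR_swap (f : R -> R -> \bar R) :
  measurable_fun setT (fun z : R * R => f z.1 z.2) -> (forall x y, 0 <= f x y) ->
  \intR_ x \intR_ y f x y = \intR_ y \intR_ x f x y.
Proof.
move=> mf f0.
exact: (@fubini_tonelli _ _ _ _ _ (@lebesgue_measure R) (@lebesgue_measure R)
  (fun z => f z.1 z.2)).
Qed.

Lemma intR_Zl f k : 0 <= k -> measurable_fun setT f ->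
  (forall x, 0 <= f x) -> \intR_ x (k * f x) = k * \intR_ x f x.
Proof. by move=> k0 mf f0; rewrite ge0_integralZl. Qed.

Lemma intR_D f g : measurable_fun setT f -> (forall x, 0 <= f x) ->
   measurable_fun setT g -> (forall x, 0 <= g x) ->
  \intR_ x (f x + g x) = \intR_ x f x + \intR_ x g x.
Proof. by move=> mf f0 mg g0; rewrite ge0_integralD. Qed.

Lemma intR_gauss : \intR_ x (expR (- x ^+ 2))%:E = (Num.sqrt (@pi R))%:E.
Proof. exact: integralT_gauss. Qed.

Lemma intR_ind_itv (a b : R) : (a <= b)%R ->
  \intR_ x ind ((a < x) && (x < b))%R = (b - a)%:E.
Proof.
move=> ab; transitivity (\intR_ x (\1_(`]a, b[%classic) x)%:E).
  by apply: eq_intR => x; rewrite /ind indicE mem_setE in_itv.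
transitivity (lebesgue_measure (`]a, b[%classic : set R)).
  by rewrite integral_indic// setIT.
rewrite lebesgue_measure_itv/= lte_fin.
case: ltP => ba; first by rewrite -EFinB.
by rewrite (_ : b = a) ?subrr//; lra.
Qed.

Lemma intR_itvE f a b (b0 b1 : bool) : measurable_fun setT f ->
  \int[lebesgue_measure]_(x in [set` Interval (BSide b0 a) (BSide b1 b)]) f x =
  \intR_ x (ind ((a < x) && (x < b))%R * f x).
Proof.
move=> mf; rewrite integral_itv_bndoo; last exact: measurable_funTS.
rewrite integral_mkcond; apply: eq_intR => x.
rewrite /patch mem_setE in_itv/= /ind.
by case: ifP; rewrite ?mul1e ?mul0e.
Qed.

Lemma intR_itvyE f a (b0 : bool) : measurable_fun setT f ->
  \int[lebesgue_measure]_(x in [set` Interval (BSide b0 a) +oo%O]) f x =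
  \intR_ x (ind (a < x)%R * f x).
Proof.
move=> mf.
have h : \int[lebesgue_measure]_(x in `]a, +oo[) f x = \intR_ x (ind (a < x)%R * f x).
  rewrite integral_mkcond; apply: eq_intR => x.
  rewrite /patch mem_setE in_itv/= /ind andbT.
  by case: ifP; rewrite ?mul1e ?mul0e.
case: b0 => //; rewrite -integral_itv_obnd_cbnd//; exact: measurable_funTS.
Qed.

Lemma intR_sym f : measurable_fun setT f -> (forall x, 0 <= f x) ->
  (forall x, f (- x)%R = f x) ->
  \intR_ x f x = 2%:E * \intR_ x (ind (0 < x)%R * f x).
Proof.
move=> mf f0 fN.
have h : \int[lebesgue_measure]_(x in `]-oo, 0%R[) f x = \intR_ x (ind (0 < x)%R * f x).
  rewrite integral_mkcond.
  rewrite -[RHS]intR_opp; [| measT | by move=> x; rewrite mule_ge0 ?ind_ge0].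
  apply: eq_intR => x; rewrite oppr_gt0 fN /patch mem_setE in_itv/= /ind.
  by case: ifP; rewrite ?mul1e ?mul0e.
transitivity (\int[lebesgue_measure]_(x in `]-oo, 0%R] `|` `]0%R, +oo[) f x).
  congr integral; apply/seteqP; split => x //= _; rewrite !in_itv/= andbT.
  by case: (lerP x 0); [left|right].
rewrite ge0_integral_setU//=.
- rewrite -integral_itv_bndo_bndc; last exact: measurable_funTS.
  by rewrite h intR_itvyE// mule_natl mule2n.
- exact: measurable_funTS.
- by apply/disj_setPS => x []/=; rewrite !in_itv/= andbT => x0 /lt_geF; rewrite x0.
Qed.

End Lebesgue1D.

Lemma sqr_add_eq0 (R : realType) (x y : R) :
  x ^+ 2 + y ^+ 2 = 0 -> x = 0 /\ y = 0.
Proof.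
move/eqP; rewrite paddr_eq0 ?sqr_ge0// !sqrf_eq0.
by case/andP => /eqP -> /eqP ->.
Qed.

(** * Rotations and polar coordinates in the plane *)

Section Plane.
Context {R : realType}.
Local Open Scope ereal_scope.
Implicit Types f : R -> R -> \bar R.

Lemma int2_shear_fst f (t : R) :
  measurable_fun setT (fun z : R * R => f z.1 z.2) -> (forall a b, 0 <= f a b) ->
  \intR_ a \intR_ b f (a + t * b)%R b = \intR_ a \intR_ b f a b.
Proof.
move=> mf f0.
rewrite intR_swap; [|sideT|sideT].
rewrite [RHS]intR_swap; [|sideT|sideT]; apply: eq_intR => b.
rewrite (@intR_shift _ (f^~ b))//.
measT.
Qed.

Lemma int2_shear_snd f (t : R) :
  measurable_fun setT (fun z : R * R => f z.1 z.2) -> (forall a b, 0 <= f a b) ->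
  \intR_ a \intR_ b f a (b + t * a)%R = \intR_ a \intR_ b f a b.
Proof.
move=> mf f0; apply: eq_intR => a; rewrite (@intR_shift _ (f a))//.
measT.
Qed.

(* A rotation of angle not multiple of pi is a product of three shears. *)
Lemma int2_rotation f (c s : R) : (c ^+ 2 + s ^+ 2 = 1)%R ->
  measurable_fun setT (fun z : R * R => f z.1 z.2) -> (forall a b, 0 <= f a b) ->
  \intR_ a \intR_ b f (c * a - s * b)%R (s * a + c * b)%R = \intR_ a \intR_ b f a b.
Proof.
move=> cs mf f0.
have [s0|s0] := eqVneq s 0%R.
  have /orP[/eqP ->|/eqP ->] : (c == 1%R) || (c == - 1)%R.
    by rewrite -eqf_sqr expr1n; move: cs; rewrite s0 expr0n addr0 => ->.
    by apply: eq_intR => a; apply: eq_intR => b; rewrite s0; congr f; ring.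
  under eq_intR => a.
    under eq_intR => b.
      rewrite (_ : -1 * a - s * b = - a)%R; last by rewrite s0; ring.
      rewrite (_ : s * a + -1 * b = - b)%R; last by rewrite s0; ring.
      over.
    rewrite (@intR_opp _ (f (- a)%R))//.
      over.
    measT.
  rewrite (@intR_opp _ (fun a => \intR_ b f a b))//.
    by apply: measurable_section_int.
  by move=> a; exact: intR_ge0.
(* For $c=\cos\theta$ and $s=\sin\theta$ this is $-\tan(\theta/2)$; the shears have parameters $t$,
   $s$, $t$. *)
pose t := ((c - 1) / s)%R.
have ts : (t * s = c - 1)%R by rewrite /t divfK.
have tc : (t * (c + 1) = - s)%R.
  apply: (mulIf s0); rewrite mulrAC ts; move: cs; nra.
transitivity (\intR_ a \intR_ b f (a + t * b + t * (b + s * (a + t * b)))%R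
   (b + s * (a + t * b))%R).
  apply: eq_intR => a; apply: eq_intR => b; congr f.
    rewrite (_ : a + _ + _ = (1 + t * s) * a + (t * (1 + (1 + t * s))) * b)%R; last by ring.
    rewrite ts (_ : 1 + (c - 1) = c)%R; last by ring.
    by rewrite (addrC 1%R c) tc; ring.
  rewrite (_ : b + _ = s * a + (1 + t * s) * b)%R; last by ring.
  by rewrite ts; ring.
rewrite (int2_shear_fst (f := fun a b => f (a + t * (b + s * a))%R (b + s * a)%R)); [|sideT|sideT].
rewrite (int2_shear_snd (f := fun a b => f (a + t * b)%R b)); [|sideT|sideT].
exact: int2_shear_fst.
Qed.

(** A rotation aligns the linear form with the first axis and leaves $a^2+b^2$ unchanged. This
    planar case is the only rotation used in higher dimension. *)
Lemma int2_rotate_linear (F : R -> R -> \bar R) (al be : R) :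
  measurable_fun setT (fun z : R * R => F z.1 z.2) -> (forall a b, 0 <= F a b) ->
  \intR_ a \intR_ b F (al * a + be * b)%R (a ^+ 2 + b ^+ 2)%R =
  \intR_ a \intR_ b F (Num.sqrt (al ^+ 2 + be ^+ 2) * a)%R (a ^+ 2 + b ^+ 2)%R.
Proof.
move=> mF F0; set r := Num.sqrt _.
have r2 : (r ^+ 2 = al ^+ 2 + be ^+ 2)%R.
  by rewrite sqr_sqrtr// addr_ge0// sqr_ge0.
have [r0|r0] := eqVneq r 0%R.
  have [-> ->] : al = 0%R /\ be = 0%R by apply: sqr_add_eq0; rewrite -r2 r0 expr0n.
  by apply: eq_intR => a; apply: eq_intR => b; rewrite r0 !mul0r addr0.
rewrite -(@int2_rotation (fun a b => F (r * a) (a ^+ 2 + b ^+ 2))%R (al / r) (- be / r)).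
- apply: eq_intR => a; apply: eq_intR => b; congr F; first by field.
  transitivity ((al ^+ 2 + be ^+ 2) / r ^+ 2 * (a ^+ 2 + b ^+ 2))%R; last by field.
  by rewrite -r2 divff ?mul1r// expf_neq0.
- rewrite (_ : _ + _ = (al ^+ 2 + be ^+ 2) / r ^+ 2)%R; last by field.
  by rewrite -r2 divff// expf_neq0.
- measT.
- by [].
Qed.

End Plane.

Section Polar.
Context {R : realType}.
Local Open Scope ereal_scope.

Lemma intR_exp_tail (s : R) :
  \intR_ w (ind (s < w)%R * (expR (- w))%:E) = (expR (- s))%:E.
Proof.
have h0 : \intR_ w (ind (0 < w)%R * (expR (- w))%:E) = 1 :> \bar R.
  transitivity (\int[@lebesgue_measure R]_x (exponential_pdf 1 x)%:E); last first.
    by rewrite integral_exponential_pdf.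
  rewrite -(@intR_itvyE _ _ _ true); last measT.
  rewrite integral_mkcond; apply: eq_intR => w.
  rewrite /patch mem_setE in_itv/= andbT; case: ifPn => w0.
    by rewrite exponential_pdfE// -[LHS]mul1e EFinM mulN1r.
  by rewrite lt0_exponential_pdf// ltNge.
rewrite -(@intR_shift _ _ s); first last.
- by move=> x; rewrite mule_ge0 ?ind_ge0// lee_fin expR_ge0.
- measT.
transitivity (\intR_ w ((expR (- s))%:E * (ind (0 < w)%R * (expR (- w))%:E))).
  apply: eq_intR => w; rewrite ltrDr opprD expRD EFinM.
  by rewrite muleA muleC.
by rewrite intR_Zl; [rewrite h0 mule1|sideT..].
Qed.

(** Area of the disc of radius $\sqrt s$, seen as the distribution function of $a^2+b^2$ under
    planar Lebesgue measure. *)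
Let D (s : R) : \bar R := \intR_ a \intR_ b ind (a ^+ 2 + b ^+ 2 <= s)%R.

Let D_scale (s : R) : (0 < s)%R -> D s = s%:E * D 1%R.
Proof.
move=> s0; rewrite {1}/D.
have q0 : (0 < Num.sqrt s)%R by rewrite sqrtr_gt0.
rewrite (@intR_scale _ _ (Num.sqrt s)); [|done|sideT|sideT].
rewrite (_ : s%:E = (Num.sqrt s)%:E * (Num.sqrt s)%:E); last first.
  by rewrite -EFinM -expr2 sqr_sqrtr// ltW.
rewrite -muleA; congr (_ * _); rewrite -intR_Zl; first last.
- by move=> a; apply: intR_ge0 => b; exact: ind_ge0.
- by measT; move=> *; exact: ind_ge0.
- by rewrite lee_fin ltW.
apply: eq_intR => a; rewrite (@intR_scale _ _ (Num.sqrt s)); [|done|sideT|sideT].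
congr (_ * _); apply: eq_intR => b; congr ind.
have e : (Num.sqrt s ^+ 2 = s)%R by rewrite sqr_sqrtr// ltW.
by rewrite !exprMn e -mulrDr -[X in (_ <= X)%R]mulr1 ler_pM2l.
Qed.

Let D1_fin : exists2 c : R, (0 <= c)%R & D 1%R = c%:E.
Proof.
have D0 : 0 <= D 1%R.
  by apply: intR_ge0 => a; apply: intR_ge0 => b; exact: ind_ge0.
(* The area of a square of side 4 around the disc; only finiteness matters. *)
have : D 1%R <= 16%:E.
  have h : \intR_ b ind ((- 2 < b) && (b < 2))%R = 4%:E :> \bar R.
    by rewrite intR_ind_itv; [congr EFin; lra | lra].
  apply: (@le_trans _ _ (\intR_ a \intR_ b
     (ind ((- 2 < a) && (a < 2))%R * ind ((- 2 < b) && (b < 2))%R))).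
    apply: ge0_le_integral => //.
    - by move=> a _; apply: intR_ge0 => b; exact: ind_ge0.
    - by measT; move=> *; exact: ind_ge0.
    - by measT; move=> *; rewrite mule_ge0 ?ind_ge0.
    move=> a _; apply: ge0_le_integral => //.
    - by move=> b _; exact: ind_ge0.
    - measT.
    - measT.
    move=> b _; rewrite -ind_and /ind lee_fin ler_nat.
    case: (lerP _ 1%R) => //= h1; rewrite lt0b.
    by apply/andP; split; apply/andP; split; nra.
  rewrite le_eqVlt; apply/orP; left; apply/eqP.
  transitivity (\intR_ a (4%:E * ind ((- 2 < a) && (a < 2))%R) : \bar R).
    apply: eq_intR => a; rewrite intR_Zl; [|sideT|sideT|sideT].
    by rewrite h muleC.
  rewrite intR_Zl; [|sideT|sideT|sideT].
  by rewrite h -EFinM; congr EFin; lra.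
move: D0; case: (D 1%R) => [c| |]//; rewrite lee_fin => c0 _.
by exists c.
Qed.

Let D_le0 (s : R) : (s <= 0)%R -> D s = 0.
Proof.
move=> s0; rewrite /D; apply: integral0_eq => a _.
transitivity (\int[@lebesgue_measure R]_(b in [set 0%R]) ind (a ^+ 2 + b ^+ 2 <= s)%R : \bar R).
  rewrite [RHS]integral_mkcond; apply: eq_intR => b; rewrite /patch.
  case: ifPn => // /negP hb; rewrite /ind; case: lerP => //= h; exfalso; apply: hb.
  by rewrite inE/=; have := sqr_ge0 a; have := sqr_ge0 b; nra.
by rewrite integral_set1.
Qed.

(** Disc area is linear in $s$, so the image of planar Lebesgue measure under $a^2+b^2$ is a
    multiple of Lebesgue measure on the positive half-line. The constant is the area of the unit
    disc, not yet identified with $\pi$. *)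
Let polar_const : exists2 c : R, (0 <= c)%R &
  forall H : R -> \bar R, measurable_fun setT H -> (forall w, 0 <= H w) ->
  \intR_ a \intR_ b H (a ^+ 2 + b ^+ 2)%R = c%:E * \intR_ w (ind (0 < w)%R * H w).
Proof.
have [c c0 Dc] := D1_fin; exists c => // H mH H0.
have DE s : D s = (c * Num.max s 0)%:E.
  have [s0|s0] := leP s 0%R; first by rewrite D_le0// mulr0.
  by rewrite D_scale// Dc -EFinM mulrC.
pose q (z : R * R) : measurableTypeR R := (z.1 ^+ 2 + z.2 ^+ 2)%R.
have mq : measurable_fun setT q by rewrite /q; measT.
pose leb2 := (@lebesgue_measure R \x @lebesgue_measure R).
have m1E (G : R -> \bar R) : measurable_fun setT G -> (forall w, 0 <= G w) ->
   \int[push_measure leb2 mq]_w G w = \intR_ a \intR_ b G (a ^+ 2 + b ^+ 2)%R.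
  move=> mG G0; rewrite integral_push//.
  apply: (@fubini_tonelli1 _ _ _ _ R (@lebesgue_measure R) (@lebesgue_measure R)
    (fun z => G (q z))) => //.
  exact: (measurableT_comp mG).
rewrite -m1E//.
have mpos : measurable (`]0%R, +oo[%classic : set (measurableTypeR R)) by exact: measurable_itv.
pose kc : {nonneg R} := NngNum c0.
pose m2 : {measure set (measurableTypeR R) -> \bar R} := mscale kc (mrestr (@lebesgue_measure R) mpos).
have m12 A : measurable A -> push_measure leb2 mq A = m2 A.
  have cover : \bigcup_k `](- k%:R)%R, (k%:R)%R]%classic = [set: R].
    rewrite -subTset => x _; exists (Num.bound `|x|) => //=.
    rewrite in_itv/=; have := archi_boundP (normr_ge0 x).
    by rewrite ltr_norml => /andP[-> /ltW].
  (* The truncations [Num.max] cover negative endpoints, and [Num.min] makes the value 0 when the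
     interval is empty. *)
  have ival a b : push_measure leb2 mq `]a, b]%classic =
      (c * (Num.max b 0 - Num.min (Num.max a 0) (Num.max b 0)))%:E.
    have [ab|ba] := leP a b; last first.
      rewrite set_itv_ge ?bnd_simp ?measure0 -?leNgt ?ltW//.
      rewrite (min_idPr _) ?subrr ?mulr0//.
      by rewrite ge_max !le_max lexx orbT ltW.
    rewrite (min_idPl _); last by rewrite ge_max !le_max lexx orbT ab.
    transitivity (\int[push_measure leb2 mq]_w ind ((a < w) && (w <= b))%R : \bar R).
      rewrite -[LHS]mul1e -integral_cst//= integral_mkcond.
      apply: eq_integral => x _; rewrite /patch mem_setE in_itv/= /ind.
      by case: ifP.
    rewrite m1E; [|measT|by move=> *; exact: ind_ge0].
    suff : \intR_ a0 \intR_ b0 ind ((a < a0 ^+ 2 + b0 ^+ 2) && (a0 ^+ 2 + b0 ^+ 2 <= b))%R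
       + D a = D b.
      rewrite !DE => h.
      have := congr1 (fun z => z - (c * Num.max a 0)%:E) h; rewrite addeK// => ->.
      by rewrite -EFinB; congr EFin; ring.
    rewrite /D -intR_D.
    - apply: eq_intR => x; rewrite -intR_D.
      + apply: eq_intR => y; rewrite /ind -EFinD -natrD; congr (_%:R%:E).
        by case: (leP _ a) => [h|]; rewrite ?(le_trans h ab)//= addn0.
      + measT.
      + by move=> *; exact: ind_ge0.
      + measT.
      + by move=> *; exact: ind_ge0.
    - by measT; move=> *; exact: ind_ge0.
    - by move=> *; apply: intR_ge0 => *; exact: ind_ge0.
    - by measT; move=> *; exact: ind_ge0.
    - by move=> *; apply: intR_ge0 => *; exact: ind_ge0.
  apply: (@measure_unique _ R (measurableTypeR R) (@ocitv R)
    (fun k => `](- k%:R)%R, (k%:R)%R]%classic) erefl (@ocitvI R)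
    (fun k => is_ocitv _ _) cover (push_measure leb2 mq) m2).
  - move=> _ [[a b] _ <-]; rewrite ival.
    transitivity (c%:E * (@lebesgue_measure R) `](Num.max a 0)%R, b]%classic); last first.
      congr (_ * lebesgue_measure _).
      apply/seteqP; split => x /=; rewrite !in_itv/= andbT gt_max.
        by move=> /andP[/andP[-> ->] ->].
      by case=> /andP[-> ->] ->.
    rewrite lebesgue_measure_itv/= lte_fin EFinM.
    congr (_ * _); case: ifPn => [h|].
      rewrite (max_idPl _); last by move: h; rewrite gt_max => /andP[_ /ltW].
      by rewrite (min_idPl _) ?EFinB// ltW.
    rewrite -leNgt => h.
    rewrite (min_idPr _) ?subrr// ge_max h.
    by rewrite le_max lexx orbT.
  - by move=> k; rewrite ival ltry.
have mD : measurable (~` `]0%R, +oo[%classic : set (measurableTypeR R)).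
  exact: measurableC.
transitivity (\int[push_measure leb2 mq]_(w in `]0%R, +oo[ `|` ~` `]0%R, +oo[) H w).
  by rewrite setUv.
rewrite ge0_integral_setU//; last 2 first.
- by rewrite setUv.
- exact/disj_setPCl.
rewrite [X in _ + X](_ : _ = 0) ?adde0; last first.
  rewrite null_set_integral//; first exact: measurable_funTS.
  rewrite m12//; transitivity (c%:E * (@lebesgue_measure R) (~` `]0%R, +oo[ `&` `]0%R, +oo[)); first by [].
  by rewrite setICl measure0 mule0.
rewrite (eq_measure_integral (mscale kc (@lebesgue_measure R))); last first.
  move=> A mA AD; apply: etrans (m12 _ mA) _.
  transitivity (c%:E * (@lebesgue_measure R) (A `&` `]0%R, +oo[)); first by [].
  by rewrite setIidl.
rewrite ge0_integral_mscale//; last exact: measurable_funTS.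
by rewrite (intR_itvyE _ false).
Qed.

(** The constant is found by testing on $e^{-w}$: the left side is the square of the Gaussian
    integral, and the half-line integral on the right is 1. *)
Lemma int2_polar (H : R -> \bar R) : measurable_fun setT H -> (forall w, 0 <= H w) ->
  \intR_ a \intR_ b H (a ^+ 2 + b ^+ 2)%R = pi%:E * \intR_ w (ind (0 < w)%R * H w).
Proof.
move=> mH H0; have [c c0 Hc] := polar_const.
suff -> : pi = c by exact: Hc.
have e0 (x : R) : 0 <= (expR x)%:E by rewrite lee_fin expR_ge0.
have := Hc (fun w => (expR (- w))%:E); rewrite intR_exp_tail oppr0 expR0 mule1.
have -> : \intR_ a \intR_ b (expR (- (a ^+ 2 + b ^+ 2)))%:E = (@pi R)%:E.
  transitivity (\intR_ a ((Num.sqrt (@pi R))%:E * (expR (- a ^+ 2))%:E)).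
    apply: eq_intR => a; under eq_intR do rewrite opprD expRD EFinM.
    by rewrite intR_Zl; [|sideT|sideT|sideT]; rewrite intR_gauss muleC.
  rewrite intR_Zl; [|sideT|sideT|sideT].
  by rewrite intR_gauss -EFinM -expr2 sqr_sqrtr// pi_ge0.
by move=> h; apply: EFin_inj; apply: h => //; measT.
Qed.

End Polar.

(** * Measures behind the iterated integrals *)

Section SigmaFinite.
Context d (T : measurableType d) (R : realType).
Variables (m : {measure set T -> \bar R}) (sf : sigma_finite setT m).

(** A copy of [m] whose head symbol carries the proof of sigma-finiteness, so that the corresponding
    structure can be declared on it. *)
Let sigma_finite_copy (_ : sigma_finite setT m) : set T -> \bar R := m.

HB.instance Definition _ := Measure.copy (sigma_finite_copy sf) m.
HB.instance Definition _ :=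
  @Measure_isSigmaFinite.Build _ _ _ (sigma_finite_copy sf) sf.

Lemma sigma_finite_pack :
  exists m' : {sigma_finite_measure set T -> \bar R}, forall A, m' A = m A.
Proof. by exists (sigma_finite_copy sf). Qed.

End SigmaFinite.

Lemma sigma_finite_prod d1 d2 (T1 : measurableType d1) (T2 : measurableType d2)
    (R : realType) (m1 : {sigma_finite_measure set T1 -> \bar R})
    (m2 : {sigma_finite_measure set T2 -> \bar R}) :
  sigma_finite setT (m1 \x m2)%E.
Proof.
have /sigma_finiteP[F [FT ndF Ffin]] := sigma_finiteT m1.
have /sigma_finiteP[G [GT ndG Gfin]] := sigma_finiteT m2.
exists (fun n => F n `*` G n); last first.
  move=> n; have [mF Foo] := Ffin n; have [mG Goo] := Gfin n.
  split; first exact: measurableX.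
  by rewrite product_measure1E// lte_mul_pinfty// ge0_fin_numE.
apply/esym; rewrite -subTset => -[x y] _.
have [i _ Fx] : (\bigcup_n F n) x by rewrite -FT.
have [j _ Gy] : (\bigcup_n G n) y by rewrite -GT.
exists (maxn i j) => //; split => /=.
- by move: x Fx; apply/subsetPset/ndF; exact: leq_maxl.
- by move: y Gy; apply/subsetPset/ndG; exact: leq_maxr.
Qed.

Section IterInt.
Context d (T : measurableType d) (R : realType).
Variables (I : (T -> \bar R) -> \bar R) (m : {sigma_finite_measure set T -> \bar R}).
Hypothesis Im : forall f, measurable_fun setT f -> (forall x, (0 <= f x)%E) ->
  I f = (\int[m]_x f x)%E.

(** By induction on [n]: the next measure is the image of [m \x mn] under [cons]. The representation
    is claimed for nonnegative measurable functions only, where Tonelli identifies it with the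
    iterated integral. *)
Lemma iter_int_measure n : exists mn : {sigma_finite_measure set (n.-tuple T) -> \bar R},
  forall f, measurable_fun setT f -> (forall x, (0 <= f x)%E) ->
  iter_int I f = (\int[mn]_x f x)%E.
Proof.
elim: n => [|n [mn mnE]].
  exists (@dirac _ (0.-tuple T) [tuple] R) => f mf f0 /=.
  by rewrite integral_dirac// diracT mul1e.
pose cns (z : T * n.-tuple T) : n.+1.-tuple T := [tuple of z.1 :: z.2].
have mcns : measurable_fun setT cns.
  exact: measurable_cons.
pose unc (t : n.+1.-tuple T) : T * n.-tuple T := (thead t, [tuple of behead t]).
have munc : measurable_fun setT unc.
  apply: measurable_fun_pair; first exact: measurable_tnth.
  exact: measurable_behead.
have cK z : unc (cns z) = z.
  by case: z => x t; rewrite /unc /cns /=; congr pair; apply: val_inj.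
(* [unc] is a measurable left inverse of [cns], so the preimages under [unc] of an exhaustion of the
   product have the same measures as its members. *)
have sf : sigma_finite setT (push_measure (m \x mn)%E mcns).
  have [F FT Ffin] := sigma_finite_prod m mn.
  exists (fun k => unc @^-1` F k).
    by rewrite -preimage_bigcup -FT preimage_setT.
  move=> k; split.
    by rewrite -[X in measurable X]setTI; apply: munc => //; exact: (Ffin k).1.
  have -> : push_measure (m \x mn)%E mcns (unc @^-1` F k) = (m \x mn)%E (F k).
    rewrite push_measureE; congr product_measure1.
    by apply/seteqP; split => z; rewrite /preimage/= cK.
  exact: (Ffin k).2.
have [m' m'E] := sigma_finite_pack sf.
exists m' => f mf f0.
transitivity (\int[push_measure (m \x mn)%E mcns]_x f x)%E; last first.
  by apply: eq_measure_integral => A _ _; exact/esym/m'E.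
rewrite integral_push//.
rewrite (fubini_tonelli1 (fun z => f (cns z))); last 2 first.
- exact: (measurableT_comp mf).
- by move=> z; exact: f0.
rewrite [LHS]/=.
have mfc : measurable_fun setT (fun z : T * n.-tuple T => f (cns z)).
  exact: (measurableT_comp mf).
rewrite Im; last 2 first.
- rewrite (_ : (fun _ => _) = fubini_F mn (fun z => f (cns z))).
    by apply: measurable_fun_fubini_tonelli_F => // z; exact: f0.
  apply/funext => x; rewrite mnE//.
  exact: (@measurableT_comp _ _ _ _ _ _ (fun z => f (cns z)) setT (pair x)).
- move=> x; rewrite mnE//; first by apply: integral_ge0.
  exact: (@measurableT_comp _ _ _ _ _ _ (fun z => f (cns z)) setT (pair x)).
apply: eq_integral => x _; rewrite mnE//.
exact: (@measurableT_comp _ _ _ _ _ _ (fun z => f (cns z)) setT (pair x)).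
Qed.

End IterInt.

Section LebCD.
Context {R : realType}.

Lemma leb_int_C_measure : exists m : {sigma_finite_measure set (R * R)%type -> \bar R},
  forall f : R * R -> \bar R, measurable_fun setT f ->
  (forall x, (0 <= f x)%E) -> leb_int_C f = (\int[m]_z f z)%E.
Proof.
pose leb2 := (@lebesgue_measure R \x @lebesgue_measure R)%E.
(* The identity, read as a map from the domain of Lebesgue measure to the measurable structure of
   [R * R] over which [CD] is built. *)
pose idR2 (z : measurableTypeR R * measurableTypeR R) : R * R := z.
have mid : measurable_fun setT idR2 by exact: measurable_id.
have sf : sigma_finite setT (push_measure leb2 mid).
  have [F FT Ff] := sigma_finite_prod (@lebesgue_measure R) (@lebesgue_measure R).
  by exists F.
have [m mE] := sigma_finite_pack sf.
exists m => f mf f0.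
transitivity (\int[push_measure leb2 mid]_z f z)%E; last first.
  by apply: eq_measure_integral => A _ _; exact/esym/mE.
rewrite integral_push//.
apply/esym.
exact: (@fubini_tonelli1 _ _ _ _ R (@lebesgue_measure R) (@lebesgue_measure R) f).
Qed.

Lemma leb_int_CD_measure D : exists m : {sigma_finite_measure set (CD R D) -> \bar R},
  forall f : CD R D -> \bar R, measurable_fun setT f ->
  (forall x, (0 <= f x)%E) -> leb_int_CD D f = (\int[m]_z f z)%E.
Proof. by have [m mE] := leb_int_C_measure; exact: iter_int_measure mE D. Qed.

(** Lebesgue measure on C^D, accessible only through its integrals of nonnegative measurable
    functions: [leb_int_CDE] and the recursion [int_CD0], [int_CDS]. *)
Definition mu_CD D : {sigma_finite_measure set (CD R D) -> \bar R} :=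
  sval (cid (leb_int_CD_measure D)).

Lemma leb_int_CDE D (f : CD R D -> \bar R) : measurable_fun setT f ->
  (forall x, (0 <= f x)%E) ->
  leb_int_CD D f = (\int[mu_CD D]_z f z)%E.
Proof. exact: (svalP (cid (leb_int_CD_measure D))). Qed.

Lemma int_CD0 (f : CD R 0 -> \bar R) : measurable_fun setT f ->
  (forall x, (0 <= f x)%E) -> (\int[mu_CD 0]_z f z = f [tuple])%E.
Proof. by move=> mf f0; rewrite -leb_int_CDE. Qed.

Lemma int_CDS D (f : CD R D.+1 -> \bar R) : measurable_fun setT f ->
  (forall x, (0 <= f x)%E) ->
  (\int[mu_CD D.+1]_z f z =
   \intR_ a \intR_ b \int[mu_CD D]_t f [tuple of (a, b) :: t])%E.
Proof.
move=> mf f0; rewrite -leb_int_CDE; [|done|done].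
apply: eq_intR => a; apply: eq_intR => b.
transitivity (leb_int_CD D (fun t : CD R D => f [tuple of (a, b) :: t])).
  by [].
rewrite leb_int_CDE//.
by apply: (measurableT_comp mf); apply: measurable_cons.
Qed.

End LebCD.
Global Opaque mu_CD.

(** Each positive variable stands for $|z_l|^2$ of one complex coordinate after passing to polar
    coordinates; the factors $\pi$ are kept outside. Functions of the sum of these variables suffice
    because only $|p|^2$ occurs. *)
Fixpoint simplex_int {R : realType} (m : nat) (g : R -> \bar R) : \bar R :=
  match m with
  | 0 => g 0
  | m'.+1 => (\intR_ v (ind (0 < v)%R * simplex_int m' (fun w => g (v + w)%R)))%E
  end.

Section SimplexInt.
Context {R : realType}.
Local Open Scope ereal_scope.

Lemma simplex_int_ge0 m (g : R -> \bar R) : (forall w, 0 <= g w) ->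
  0 <= simplex_int m g.
Proof.
elim: m g => [|m IH] g g0 /=; first exact: g0.
by nnT; apply: IH => w; exact: g0.
Qed.

Lemma eq_simplex_int m (f g : R -> \bar R) : f =1 g ->
  simplex_int m f = simplex_int m g.
Proof. by move=> /funext ->. Qed.

Lemma measurable_simplex_int m d (S : measurableType d) (f : S -> R -> \bar R) :
  measurable_fun setT (fun z : S * R => f z.1 z.2) -> (forall s w, 0 <= f s w) ->
  measurable_fun setT (fun s => simplex_int m (f s)).
Proof.
elim: m d S f => [|m IH] d S f mf f0 /=; first by measT.
apply: measurable_section_int; last first.
  by move=> s v; nnT; exact: simplex_int_ge0.
apply: emeasurable_funM; first by measT.
apply: (IH _ _ (fun (z : S * R) w => f z.1 (z.2 + w)%R)) => //.
by measT.
Qed.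

End SimplexInt.

Ltac nnT_ext ::=
  lazymatch goal with
  | |- is_true (Order.le _ (simplex_int _ _)) => apply: simplex_int_ge0; intros; nnT
  end.

(** * Integration over C^D *)

Section ComplexSpace.
Context {R : realType}.
Implicit Types D : nat.

Definition cip D (u p : CD R D) : R :=
  \sum_(l < D) ((tnth u l).1 * (tnth p l).1 + (tnth u l).2 * (tnth p l).2).

Definition csq D (p : CD R D) : R :=
  \sum_(l < D) ((tnth p l).1 ^+ 2 + (tnth p l).2 ^+ 2).

Definition cadd D (p u : CD R D) : CD R D :=
  [tuple ((tnth p l).1 + (tnth u l).1, (tnth p l).2 + (tnth u l).2) | l < D].

Lemma csq_ge0 D (p : CD R D) : 0 <= csq p.
Proof. by apply: sumr_ge0 => l _; rewrite addr_ge0 ?sqr_ge0. Qed.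

Lemma csq_cons D (z : R * R) (p : CD R D) :
  csq ([tuple of z :: p] : CD R D.+1) = z.1 ^+ 2 + z.2 ^+ 2 + csq p.
Proof.
rewrite /csq big_ord_recl tnth0; congr (_ + _).
by apply: eq_bigr => i _; rewrite !tnthS.
Qed.

Lemma cip_cons D (y z : R * R) (u p : CD R D) :
  cip ([tuple of y :: u] : CD R D.+1) [tuple of z :: p] =
  y.1 * z.1 + y.2 * z.2 + cip u p.
Proof.
rewrite /cip big_ord_recl !tnth0; congr (_ + _).
by apply: eq_bigr => i _; rewrite !tnthS.
Qed.

Lemma cadd_cons D (y z : R * R) (u p : CD R D) :
  cadd ([tuple of y :: u] : CD R D.+1) [tuple of z :: p] =
  [tuple of (y.1 + z.1, y.2 + z.2) :: cadd u p].
Proof.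
apply: eq_from_tnth => i; rewrite tnth_mktuple.
case: (unliftP ord0 i) => [j|] ->; first by rewrite !tnthS tnth_mktuple.
by rewrite !tnth0.
Qed.

Lemma csq_cadd D (p u : CD R D) : csq (cadd p u) = csq p + 2 * cip u p + csq u.
Proof.
rewrite /csq /cip mulr_sumr -!big_split /=; apply: eq_bigr => l _.
by rewrite tnth_mktuple /=; ring.
Qed.

Lemma measurable_csq D d (S : measurableType d) (f : S -> CD R D) :
  measurable_fun setT f -> measurable_fun setT (fun s => csq (f s)).
Proof. by move=> mf; rewrite /csq; measT. Qed.

Lemma measurable_cip D d (S : measurableType d) (u f : S -> CD R D) :
  measurable_fun setT u -> measurable_fun setT f ->
  measurable_fun setT (fun s => cip (u s) (f s)).
Proof. by move=> mu mf; rewrite /cip; measT. Qed.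

Lemma measurable_cadd D d (S : measurableType d) (u f : S -> CD R D) :
  measurable_fun setT u -> measurable_fun setT f ->
  measurable_fun setT (fun s => cadd (u s) (f s)).
Proof.
move=> mu mf; apply/measurable_fun_tnthP => i /=.
rewrite (_ : _ \o _ = fun s => ((tnth (u s) i).1 + (tnth (f s) i).1,
  (tnth (u s) i).2 + (tnth (f s) i).2)); first by measT.
by apply/funext => z /=; rewrite tnth_mktuple.
Qed.

Lemma cip_cadd D (x u : CD R D) : cip x (cadd x u) = csq x + cip x u.
Proof.
rewrite /csq /cip -big_split /=; apply: eq_bigr => l _.
by rewrite tnth_mktuple /=; ring.
Qed.

Lemma cipC D (x u : CD R D) : cip x u = cip u x.
Proof. by apply: eq_bigr => l _; rewrite mulrC (mulrC (tnth x l).2). Qed.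

End ComplexSpace.

Ltac measT_ext ::=
  lazymatch goal with
  | |- measurable_fun _ (fun x => simplex_int _ _) =>
      apply: measurable_simplex_int; [measT|]
  | |- measurable_fun _ (fun x => csq _) => apply: measurable_csq; measT
  | |- measurable_fun _ (fun x => cip _ _) => apply: measurable_cip; measT
  | |- measurable_fun _ (fun x => cadd _ _) => apply: measurable_cadd; measT
  end.

Section ComplexSpaceIntegral.
Context {R : realType}.
Implicit Types D : nat.
Local Open Scope ereal_scope.

Lemma int_CD_shift D (x : CD R D) (f : CD R D -> \bar R) :
  measurable_fun setT f -> (forall y, 0 <= f y) ->
  \int[mu_CD D]_y f (cadd x y) = \int[mu_CD D]_y f y.
Proof.
elim: D x f => [|D IH] x f mf f0.
  rewrite int_CD0; [|sideT|done]; rewrite int_CD0//.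
  by rewrite [cadd _ _]tuple0.
case/tupleP: x => -[x1 x2] x.
have mfc : measurable_fun setT (fun z : R * R * CD R D => f [tuple of z.1 :: z.2]).
  exact: (measurableT_comp mf (measurable_cons measurable_fst measurable_snd)).
rewrite int_CDS; [|sideT|done]; rewrite int_CDS; [|done|done].
pose g a b := \int[mu_CD D]_t f [tuple of (a, b) :: t].
have g0 a b : 0 <= g a b by apply: integral_ge0.
have mg : measurable_fun setT (fun z : R * R => g z.1 z.2).
  rewrite /g; sideT.
transitivity (\intR_ a \intR_ b g (a + x1)%R (b + x2)%R).
  apply: eq_intR => a; apply: eq_intR => b.
  under eq_integral do rewrite cadd_cons /=.
  rewrite addrC (addrC x2) /g -(IH x)//.
  sideT.
rewrite (intR_shift (f := fun a => \intR_ b g a (b + x2)%R)); [|sideT|sideT].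
by apply: eq_intR => a; rewrite (intR_shift (f := g a)); [|sideT|sideT].
Qed.

(** The vector [u] is rotated onto a real axis of length $|u|$; all other complex coordinates enter
    only through their squared moduli. Ball volumes and the overlap of two balls are both
    instances. *)
Lemma int_CD_linear_sq D (u : CD R D.+1) (F : R -> R -> \bar R) :
  measurable_fun setT (fun z : R * R => F z.1 z.2) -> (forall a b, 0 <= F a b) ->
  \int[mu_CD D.+1]_p F (cip u p) (csq p) =
  (pi ^+ D)%:E * \intR_ a \intR_ b simplex_int D
    (fun w => F (Num.sqrt (csq u) * a)%R (a ^+ 2 + b ^+ 2 + w)%R).
Proof.
elim: D u F => [|D IH] u F mF F0.
  rewrite int_CDS; last by move=> *; exact: F0.
    rewrite expr0 mul1e; case/tupleP: u => u0 u /=.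
    transitivity (\intR_ a \intR_ b F (u0.1 * a + u0.2 * b)%R (a ^+ 2 + b ^+ 2)%R).
      apply: eq_intR => a; apply: eq_intR => b; rewrite int_CD0//.
        by rewrite csq_cons cip_cons /csq /cip !big_ord0 !addr0.
      sideT.
    rewrite int2_rotate_linear; [|exact: mF|exact: F0].
    apply: eq_intR => a; apply: eq_intR => b.
    by rewrite csq_cons /csq big_ord0 !addr0.
  sideT.
case/tupleP: u => u0 u; set r := Num.sqrt (csq u).
pose r0 := Num.sqrt (u0.1 ^+ 2 + u0.2 ^+ 2).
have rE : Num.sqrt (csq ([tuple of u0 :: u] : CD R D.+2)) = Num.sqrt (r0 ^+ 2 + r ^+ 2).
  rewrite csq_cons !sqr_sqrtr//; first exact: csq_ge0.
  by rewrite addr_ge0 ?sqr_ge0.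
rewrite int_CDS; [|sideT|sideT].
pose G al be := \intR_ a' \intR_ b' simplex_int D
  (fun w => F (al + r * a')%R (be + (a' ^+ 2 + b' ^+ 2 + w))%R).
have mG : measurable_fun setT (fun z : R * R => G z.1 z.2) by rewrite /G; sideT.
have G0 al be : 0 <= G al be by rewrite /G; sideT.
have pi0 n : 0 <= (@pi R ^+ n)%:E by rewrite lee_fin exprn_ge0// pi_ge0.
transitivity (\intR_ a \intR_ b ((pi ^+ D)%:E * G (u0.1 * a + u0.2 * b)%R (a ^+ 2 + b ^+ 2)%R)).
  apply: eq_intR => a; apply: eq_intR => b; rewrite /G.
  rewrite -(IH u (fun al be => F (u0.1 * a + u0.2 * b + al) (a ^+ 2 + b ^+ 2 + be))%R); [|sideT|sideT].
  by apply: eq_integral => t _; rewrite csq_cons cip_cons.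
transitivity ((pi ^+ D)%:E * \intR_ a \intR_ b G (u0.1 * a + u0.2 * b)%R (a ^+ 2 + b ^+ 2)%R).
  rewrite -intR_Zl; [|sideT|sideT|sideT].
  by apply: eq_intR => a; rewrite intR_Zl; [|sideT|sideT|sideT].
rewrite int2_rotate_linear; [|exact: mG|exact: G0].
(* After one coordinate is split off, the form is $r_0a+ra'$. A rotation in the plane of $(a,a')$
   merges its two terms, and the pair $(b,b')$, now purely radial, becomes one more simplex variable
   with a factor $\pi$. *)
pose H al be := \intR_ b \intR_ b' simplex_int D
  (fun w => F al (be + (b ^+ 2 + b' ^+ 2 + w))%R).
have mH : measurable_fun setT (fun z : R * R => H z.1 z.2) by rewrite /H; sideT.
have H0 al be : 0 <= H al be by rewrite /H; sideT.
transitivity ((pi ^+ D)%:E * \intR_ a \intR_ a' H (r0 * a + r * a')%R (a ^+ 2 + a' ^+ 2)%R).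
  apply: (congr1 (fun z => (pi ^+ D)%:E * z)); apply: eq_intR => a; rewrite /G /H.
  rewrite (intR_swap (f := fun b a' => \intR_ b' simplex_int D
    (fun w => F (r0 * a + r * a')%R (a ^+ 2 + b ^+ 2 + (a' ^+ 2 + b' ^+ 2 + w))%R))); [|sideT|sideT].
  apply: eq_intR => a'; apply: eq_intR => b; apply: eq_intR => b'.
  by apply: eq_simplex_int => w; congr F; ring.
rewrite int2_rotate_linear; [|exact: mH|exact: H0].
rewrite -rE exprSr EFinM -muleA; apply: (congr1 (fun z => (pi ^+ D)%:E * z)).
rewrite -intR_Zl; [|sideT|sideT|sideT].
apply: eq_intR => a; rewrite -intR_Zl; [|sideT|sideT|sideT].
apply: eq_intR => a'; rewrite /H.
rewrite (int2_polar (H := fun v => simplex_int D (fun w => F (Num.sqrt (csq [tuple of u0 :: u]) * a)%R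
   (a ^+ 2 + a' ^+ 2 + (v + w))%R))); [|sideT|sideT].
by [].
Qed.

Lemma int_CD_sq D (g : R -> \bar R) :
  measurable_fun setT g -> (forall w, 0 <= g w) ->
  \int[mu_CD D.+1]_p g (csq p) = (pi ^+ D.+1)%:E * simplex_int D.+1 g.
Proof.
move=> mg g0; pose u : CD R D.+1 := [tuple (0, 0)%R | l < D.+1].
rewrite (int_CD_linear_sq u (F := fun _ be => g be)); [|sideT|sideT].
rewrite exprSr EFinM -muleA; apply: (congr1 (fun z => (pi ^+ D)%:E * z)).
by rewrite (int2_polar (H := fun v => simplex_int D (fun w => g (v + w)%R))); [|sideT|sideT].
Qed.

End ComplexSpaceIntegral.

(** * Simplex volumes and half-integer Gamma integrals *)

Section GammaIntegrals.
Context {R : realType}.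
Implicit Types (f F : R -> R) (a b q v : R).

(** Derivability is asked only in the open interval, because the primitives below contain
    [Num.sqrt], which has no derivative at 0. *)
Lemma intR_FTC f F a b : a <= b -> continuous f -> continuous F ->
  (forall x : R, a < x -> x < b -> derivable F x 1 /\ 'D_1 F x = f x) ->
  (\intR_ x (ind ((a < x)%R && (x < b)%R) * (f x)%:E) = (F b - F a)%:E)%E.
Proof.
move=> ab cf cF dF.
have mf : measurable_fun setT (EFin \o f).
  by apply/measurable_EFinP; exact: continuous_measurable_fun.
rewrite -(@intR_itvE _ (EFin \o f) a b true false)//.
move: ab; rewrite le_eqVlt => /orP[/eqP ->|ab].
  by rewrite set_itv1 integral_set1 subrr.
rewrite (@continuous_FTC2 _ _ F)//.
- exact: continuous_subspaceT.
- split.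
  + by move=> x; rewrite in_itv/= => /andP[ax xb]; have [] := dF x ax xb.
  + exact/cvg_at_right_filter/cF.
  + exact/cvg_at_left_filter/cF.
- move=> x; rewrite in_itv/= => /andP[ax xb].
  by rewrite derive1E; have [] := dF x ax xb.
Qed.

Lemma intR_pow (m : nat) q : 0 <= q ->
  (\intR_ v (ind ((0 < v)%R && (v < q)%R) * (v ^+ m)%:E) =
   (q ^+ m.+1 / m.+1%:R)%:E)%E.
Proof.
move=> q0; rewrite (@intR_FTC (fun v : R => v ^+ m) (fun v : R => v ^+ m.+1 / m.+1%:R) 0 q)//.
- by rewrite expr0n/= mul0r subr0.
- exact: exprn_continuous.
- by move=> x; apply: cvgMl; exact: exprn_continuous.
- move=> x _ _.
  have h : is_derive x (1 : R) (fun v : R => v ^+ m.+1) (m.+1%:R * x ^+ m).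
    split; first exact: exprn_derivable.
    by rewrite exp_derive scaler1.
  pose k := (m.+1%:R^-1 : R).
  have h3 : is_derive x (1 : R) (fun v : R => v ^+ m.+1 / m.+1%:R) (x ^+ m).
    have := is_deriveM h (is_derive_cst k x 1).
    rewrite /k => h3; apply: is_derive_eq.
    rewrite scaler0 add0r /GRing.scale /= mulrA mulVf ?mul1r// pnatr_eq0.
  by case: h3.
Qed.

Lemma intR_pow_sqrt (j : nat) v : 0 <= v ->
  (\intR_ q (ind ((0 < q)%R && (q < v)%R) * (q ^+ j * Num.sqrt q)%:E) =
   (v ^+ j.+1 * Num.sqrt v / (j%:R + 3 / 2))%:E)%E.
Proof.
move=> v0.
have jp : (j%:R + 3 / 2 : R) != 0 by rewrite gt_eqF// ltr_wpDl// divr_gt0.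
rewrite (@intR_FTC (fun q => q ^+ j * Num.sqrt q)
  (fun q => q ^+ j.+1 * Num.sqrt q / (j%:R + 3 / 2)) 0 v)//.
- by rewrite sqrtr0 mulr0 mul0r subr0.
- by move=> x; apply: cvgM; [exact: exprn_continuous|exact: sqrt_continuous].
- by move=> x; apply: cvgMl; apply: cvgM; [exact: exprn_continuous|exact: sqrt_continuous].
- move=> x x0 _.
  have h : is_derive x (1 : R) (fun v : R => v ^+ j.+1) (j.+1%:R * x ^+ j).
    split; first exact: exprn_derivable.
    by rewrite exp_derive scaler1.
  have h2 := is_derive1_sqrt x0.
  pose k := ((j%:R + 3 / 2)^-1 : R).
  have h3 : is_derive x (1 : R) (fun q : R => q ^+ j.+1 * Num.sqrt q / (j%:R + 3 / 2)) (x ^+ j * Num.sqrt x).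
    have h4 := is_deriveM h h2.
    have := is_deriveM h4 (is_derive_cst k x 1).
    rewrite /k => h5; apply: is_derive_eq.
    rewrite scaler0 add0r /GRing.scale /=.
    have s0 : Num.sqrt x != 0 by rewrite gt_eqF// sqrtr_gt0.
    move: s0 (sqr_sqrtr (ltW x0)); move: (Num.sqrt x) => s s0 <-.
    have -> : (s ^+ 2) ^+ j.+1 = (s ^+ 2) ^+ j * s ^+ 2 by rewrite exprSr.
    rewrite -natr1; field.
    by rewrite s0 gt_eqF// ltr_wpDl// mulr_ge0.
  by case: h3.
Qed.

Local Open Scope ereal_scope.

Lemma intR_reflect (g : R -> \bar R) (c : R) : measurable_fun setT g ->
  (forall x, 0 <= g x) -> \intR_ v g (c - v)%R = \intR_ v g v.
Proof.
move=> mg g0; rewrite -(intR_shift c mg g0).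
rewrite -(intR_opp (f := fun v => g (v + c)%R)); [|sideT|sideT].
by apply: eq_intR => v; rewrite addrC.
Qed.

Lemma intR_ind_le (g : R -> \bar R) a b : measurable_fun setT g ->
  \intR_ x (ind ((a < x)%R && (x <= b)%R) * g x) =
  \intR_ x (ind ((a < x)%R && (x < b)%R) * g x).
Proof.
move=> mg; rewrite -(intR_itvE _ _ false false mg) [RHS]integral_mkcond.
apply: eq_intR => x; rewrite /patch mem_setE in_itv/= /ind.
by case: ifP; rewrite ?mul1e ?mul0e.
Qed.

(** Convolution of densities: $\int_0^q (q-v)^m/m!\,dv=q^{m+1}/(m+1)!$. *)
Lemma simplex_int_density m (g : R -> \bar R) :
  measurable_fun setT g -> (forall w, 0 <= g w) ->
  simplex_int m.+1 g =
  \intR_ q (ind (0 < q)%R * ((q ^+ m / m`!%:R)%:E * g q)).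
Proof.
elim: m g => [|m IH] g mg g0.
  apply: eq_intR => v; rewrite /= addr0 expr0 fact0 divr1 mul1e.
  by [].
transitivity (\intR_ v (ind (0 < v)%R * simplex_int m.+1 (fun w => g (v + w)%R))).
  by [].
transitivity (\intR_ v \intR_ q (ind (0 < v)%R *
    (ind (v < q)%R * (((q - v) ^+ m / m`!%:R)%:E * g q)))).
  apply: eq_intR => v; rewrite IH; [|sideT|sideT].
  rewrite -intR_Zl; [|sideT|sideT|sideT].
  rewrite -(intR_shift (f := fun q => ind (0 < v)%R *
    (ind (v < q)%R * (((q - v) ^+ m / m`!%:R)%:E * g q))) v); [|sideT|sideT].
  by apply: eq_intR => q; rewrite ltrDr addrK (addrC v).
rewrite (intR_swap (f := fun v q => ind (0 < v)%R *
    (ind (v < q)%R * (((q - v) ^+ m / m`!%:R)%:E * g q)))); [|sideT|sideT].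
apply: eq_intR => q.
transitivity (g q * \intR_ v (ind ((0 < v) && (v < q))%R * ((q - v) ^+ m / m`!%:R)%:E)).
  rewrite -intR_Zl; [|sideT|sideT|sideT].
  by apply: eq_intR => v; rewrite ind_and -!muleA [RHS]muleC -!muleA.
rewrite -(intR_reflect (g := fun v => ind ((0 < v) && (v < q))%R * ((q - v) ^+ m / m`!%:R)%:E) q); [|sideT|sideT].
transitivity (g q * \intR_ v ((m`!%:R^-1)%:E * (ind ((0 < v) && (v < q))%R * (v ^+ m)%:E))).
  congr (_ * _); apply: eq_intR => v.
  rewrite subr_gt0 ltrBlDr ltrDl andbC (_ : q - (q - v) = v)%R; last by ring.
  by rewrite [RHS]muleCA EFinM (muleC (v ^+ m)%:E).
rewrite intR_Zl; [|sideT|sideT|sideT].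
have [q0|q0] := ltP 0%R q; last first.
  rewrite (_ : \intR_ v _ = 0); first by rewrite !mule0 mul0e.
  apply: integral0_eq => v _; rewrite /ind; case: ltP => //= v0; last by rewrite mul0e.
  by rewrite ltNge (le_trans q0 (ltW v0)) mul0e.
rewrite intR_pow ?ltW// /ind mul1e muleC -EFinM; congr (_%:E * _).
by rewrite factS natrM invfM; ring.
Qed.

Lemma simplex_int_expR m (s : R) :
  simplex_int m (fun w => (expR (- (s + w)))%:E) = (expR (- s))%:E.
Proof.
elim: m s => [|m IH] s; first by rewrite /= addr0.
transitivity (\intR_ v ((expR (- s))%:E * (ind (0 < v)%R * (expR (- v))%:E))).
  apply: eq_intR => v; rewrite muleCA; congr (_ * _).
  transitivity (simplex_int m (fun w => (expR (- (s + v + w)))%:E)).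
    by apply: eq_simplex_int => w; rewrite addrA.
  by rewrite IH opprD expRD EFinM.
rewrite intR_Zl; [|sideT|sideT|sideT].
by rewrite intR_exp_tail oppr0 expR0 mule1.
Qed.

Lemma simplex_int_ind m (s : R) :
  simplex_int m (fun w => ind (w < s)%R) = ind (0 < s)%R * (s ^+ m / m`!%:R)%:E.
Proof.
case: m => [|m]; first by rewrite /= expr0 fact0 divr1 mule1.
rewrite simplex_int_density; [|sideT|sideT].
transitivity (\intR_ q ((m`!%:R^-1)%:E * (ind ((0 < q) && (q < s))%R * (q ^+ m)%:E))).
  apply: eq_intR => q; rewrite ind_and EFinM -!muleA; rewrite [RHS]muleCA; congr (_ * _).
  by rewrite muleCA; congr (_ * _); rewrite muleC.
rewrite intR_Zl; [|sideT|sideT|sideT].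
have [s0|s0] := ltP 0%R s; last first.
  rewrite (_ : \intR_ v _ = 0); first by rewrite mule0 /ind mul0e.
  apply: integral0_eq => v _; rewrite /ind; case: ltP => //= v0; last by rewrite mul0e.
  by rewrite ltNge (le_trans s0 (ltW v0)) mul0e.
rewrite intR_pow ?ltW// /ind mul1e -EFinM; congr EFin.
by rewrite factS natrM invfM; ring.
Qed.

(** This is $\Gamma(j+3/2)$. *)
Definition gamma_half (j : nat) : \bar R :=
  \intR_ q (ind (0 < q)%R * (q ^+ j * Num.sqrt q * expR (- q))%:E).

Lemma gamma_half_ge0 j : 0 <= gamma_half j.
Proof. by rewrite /gamma_half; sideT. Qed.

(** The functional equation $\Gamma(x+1)=x\Gamma(x)$ at $x=j+3/2$. Writing $e^{-q}$ as the integral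
    of $e^{-v}$ over $v>q$ and exchanging works in [\bar R], before finiteness of [gamma_half] is
    known. *)
Lemma gamma_halfS j : gamma_half j.+1 = (j%:R + 3 / 2)%:E * gamma_half j.
Proof.
have jp : (0 < j%:R + 3 / 2 :> R)%R by rewrite ltr_wpDl// divr_gt0.
have jm : gamma_half j = ((j%:R + 3 / 2)^-1)%:E * gamma_half j.+1; last first.
  by rewrite jm muleA -EFinM divff ?mul1e// gt_eqF.
transitivity (\intR_ q \intR_ v (ind (0 < q)%R *
   (ind (q < v)%R * (q ^+ j * Num.sqrt q * expR (- v))%:E)) : \bar R).
  rewrite /gamma_half; apply: eq_intR => q.
  transitivity (ind (0 < q)%R * (q ^+ j * Num.sqrt q)%:E * \intR_ v (ind (q < v)%R * (expR (- v))%:E)).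
    by rewrite intR_exp_tail -muleA.
  rewrite -intR_Zl; [|sideT|sideT|sideT].
  by apply: eq_intR => v; rewrite [in RHS]EFinM -!muleA; congr (_ * _); rewrite muleCA.
rewrite (intR_swap (f := fun q v => ind (0 < q)%R *
   (ind (q < v)%R * (q ^+ j * Num.sqrt q * expR (- v))%:E))); [|sideT|sideT].
rewrite /gamma_half -intR_Zl; [|sideT|sideT|sideT].
apply: eq_intR => v.
transitivity ((expR (- v))%:E * \intR_ q (ind ((0 < q) && (q < v))%R * (q ^+ j * Num.sqrt q)%:E)).
  rewrite -intR_Zl; [|sideT|sideT|sideT].
  by apply: eq_intR => q; rewrite ind_and EFinM -!muleA [RHS]muleC -!muleA.
have [v0|v0] := ltP 0%R v; last first.
  rewrite (_ : \intR_ q _ = 0); first by rewrite mule0 /ind mul0e mule0.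
  apply: integral0_eq => q _; rewrite /ind; case: ltP => //= q0; last by rewrite mul0e.
  by rewrite ltNge (le_trans v0 (ltW q0)) mul0e.
rewrite intR_pow_sqrt ?ltW// /ind mul1e -!EFinM; congr EFin.
by ring.
Qed.

End GammaIntegrals.

(** * Balls and their translates *)

Ltac congr_mule :=
  lazymatch goal with
  | |- (?a * _)%E = _ => apply: (congr1 (fun z => (a * z)%E))
  end.

Ltac mule_ac :=
  rewrite -?muleA;
  repeat lazymatch goal with
  | |- (?a * _)%E = (?a * _)%E => congr_mule
  | |- (?a * _)%E = _ =>
      first [rewrite [in RHS](muleCA _ a) | rewrite [in RHS](muleC _ a)]
  end; try reflexivity.

Section BallOverlap.
Context {R : realType}.
Variable n : nat.
Local Open Scope ereal_scope.

(* The volume of the ball of radius sqrt y in R^(2n+1), divided by pi^n. *)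
Definition slice_vol (y : R) : \bar R :=
  \intR_ b simplex_int n (fun w => ind (w < y - b ^+ 2)%R).

Lemma slice_vol_ge0 y : 0 <= slice_vol y.
Proof. by rewrite /slice_vol; sideT. Qed.

Lemma measurable_slice_vol : measurable_fun setT slice_vol.
Proof. by rewrite /slice_vol; sideT. Qed.

Let sv0 := slice_vol_ge0.
(* Puts the measurability in the proof context, where measT looks for it. *)
Let msv := measurable_slice_vol.

Lemma slice_volE y : slice_vol y =
  \intR_ b (ind (b ^+ 2 < y)%R * ((y - b ^+ 2) ^+ n / n`!%:R)%:E).
Proof. by apply: eq_intR => b; rewrite simplex_int_ind subr_gt0. Qed.

(** Homogeneity of degree $n+1/2$. For $y\le 0$ the ball is empty and [Num.sqrt y] is 0, so no sign
    condition on [y] is required. *)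
Lemma slice_vol_scale y : slice_vol y = (y ^+ n * Num.sqrt y)%:E * slice_vol 1.
Proof.
have [y0|y0] := leP y 0%R.
  rewrite (ler0_sqrtr y0) mulr0 mul0e slice_volE; apply: integral0_eq => b _.
  by rewrite /ind ltNge (le_trans y0 (sqr_ge0 b)) mul0e.
have q0 : (0 < Num.sqrt y)%R by rewrite sqrtr_gt0.
have q2 : (Num.sqrt y ^+ 2 = y)%R by rewrite sqr_sqrtr// ltW.
rewrite {1}slice_volE (intR_scale q0); [|sideT|].
  rewrite (mulrC (y ^+ n)%R) EFinM -muleA; congr_mule.
  rewrite slice_volE -intR_Zl; [|by rewrite lee_fin exprn_ge0// ltW|sideT|sideT].
  apply: eq_intR => b.
  have -> : (y - (Num.sqrt y * b) ^+ 2 = y * (1 - b ^+ 2))%R by rewrite exprMn q2; ring.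
  rewrite exprMn q2 -[X in (_ < X)%R]mulr1 ltr_pM2l// [RHS]muleCA; congr_mule.
  by rewrite exprMn -mulrA EFinM.
by move=> b; apply: ind_mule_ge0 => h; nnT.
Qed.

(** Two evaluations of the integral of $e^{-q}$ times [slice_vol q] over $q>0$: homogeneity gives
    the left side, while exchanging with the slice variable $b$ leaves a Gaussian in $b$ times
    $\int_0^\infty q^ne^{-q}/n!\,dq=1$. *)
Lemma slice_vol_gamma_half : slice_vol 1 * gamma_half n = (Num.sqrt (@pi R))%:E.
Proof.
transitivity (\intR_ q (ind (0 < q)%R * ((expR (- q))%:E * slice_vol q))).
  rewrite /gamma_half -intR_Zl; [|exact: sv0|sideT|sideT].
  apply: eq_intR => q; rewrite (slice_vol_scale q) !EFinM.
  by mule_ac.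
transitivity (\intR_ q \intR_ b (ind (b ^+ 2 < q)%R *
  ((expR (- q))%:E * ((q - b ^+ 2) ^+ n / n`!%:R)%:E)) : \bar R).
  apply: eq_intR => q; rewrite slice_volE -intR_Zl; [|sideT|sideT|sideT].
  rewrite -intR_Zl; [|sideT|sideT|sideT].
  apply: eq_intR => b.
  transitivity ((ind (0 < q)%R * ind (b ^+ 2 < q)%R) *
    ((expR (- q))%:E * ((q - b ^+ 2) ^+ n / n`!%:R)%:E)); first by mule_ac.
  rewrite -ind_and; congr (ind _ * _).
  case: (ltP (b ^+ 2)%R q) => h; rewrite ?andbF// andbT.
  by apply/idP; exact: le_lt_trans (sqr_ge0 b) h.
rewrite (intR_swap (f := fun q b => ind (b ^+ 2 < q)%R *
  ((expR (- q))%:E * ((q - b ^+ 2) ^+ n / n`!%:R)%:E))); [|sideT|sideT].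
rewrite -[RHS]intR_gauss; apply: eq_intR => b.
rewrite -(intR_shift (b ^+ 2)%R); [|sideT|sideT].
transitivity ((expR (- b ^+ 2))%:E * \intR_ q (ind (0 < q)%R * ((q ^+ n / n`!%:R)%:E * (expR (- q))%:E))).
  rewrite -intR_Zl; [|sideT|sideT|sideT].
  apply: eq_intR => q; rewrite ltrDr addrK opprD expRD EFinM.
  by mule_ac.
rewrite -(simplex_int_density n (g := fun w => (expR (- w))%:E)); [|sideT|sideT].
transitivity ((expR (- b ^+ 2))%:E * simplex_int n.+1 (fun w => (expR (- (0 + w)))%:E)).
  by congr_mule; apply: eq_simplex_int => w; rewrite add0r.
by rewrite simplex_int_expR oppr0 expR0 mule1.
Qed.

Lemma int_ball_slice (S : R) :
  \int[mu_CD n.+1]_p ind (csq p < S)%R =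
  (pi ^+ n)%:E * \intR_ a slice_vol (S - a ^+ 2)%R.
Proof.
(* The linear form is absent from this integrand, so any vector serves; the reduction is used only
   to slice the ball along a real axis. *)
pose u : CD R n.+1 := [tuple (0, 0)%R | l < n.+1].
rewrite (int_CD_linear_sq u (F := fun _ be => ind (be < S)%R)); [|sideT|sideT].
apply: (congr1 (fun z => (pi ^+ n)%:E * z)).
apply: eq_intR => a; apply: eq_intR => b; apply: eq_simplex_int => w.
by congr ind; rewrite addrC -ltrBrDr opprD addrA.
Qed.

Lemma slice_vol_half_line (S r : R) : (0 <= r)%R ->
  \intR_ a slice_vol (S - (`|a| + r) ^+ 2)%R =
  2%:E * \intR_ t (ind (r < t)%R * slice_vol (S - t ^+ 2)%R).
Proof.
move=> r0; rewrite intR_sym; [|sideT|sideT|by move=> x; rewrite normrN].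
congr_mule.
rewrite -(intR_shift (f := fun t => ind (r < t)%R * slice_vol (S - t ^+ 2)%R) r); [|sideT|sideT].
apply: eq_intR => a; rewrite ltrDr /ind; case: (ltP 0%R a) => a0; last by rewrite !mul0e.
by rewrite gtr0_norm.
Qed.

Lemma int_ball_sym (S : R) :
  \int[mu_CD n.+1]_p ind (csq p < S)%R =
  (pi ^+ n)%:E * (2%:E * \intR_ t (ind (0 < t)%R * slice_vol (S - t ^+ 2)%R)).
Proof.
rewrite int_ball_slice -(@slice_vol_half_line S 0); [|exact: lexx].
apply: (congr1 (fun z => (pi ^+ n)%:E * z)).
by apply: eq_intR => a; rewrite addr0 real_normK// num_real.
Qed.

(** With $\rho=|u|$ and the origin moved halfway between the two centres, the two conditions become
    the single one $(|a|+\rho/2)^2+b^2+w<S$. The overlap thus consists of two equal caps, each cut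
    off at height $\rho/2$ from the centre. *)
Lemma int_ball_overlap (S : R) (u : CD R n.+1) :
  \int[mu_CD n.+1]_x ind ((csq x < S) && (csq x + 2 * cip u x + csq u < S))%R =
  (pi ^+ n)%:E * (2%:E * \intR_ t (ind (Num.sqrt (csq u) / 2 < t)%R * slice_vol (S - t ^+ 2)%R)).
Proof.
rewrite (int_CD_linear_sq u (F := fun al be => ind ((be < S) && (be + 2 * al + csq u < S))%R)); [|sideT|sideT].
apply: (congr1 (fun z => (pi ^+ n)%:E * z)).
set rho := Num.sqrt (csq u).
have rho2 : (csq u = rho ^+ 2)%R by rewrite sqr_sqrtr// csq_ge0.
rewrite -slice_vol_half_line; last by rewrite divr_ge0// sqrtr_ge0.
rewrite -(intR_shift (f := fun a => \intR_ b simplex_int n (fun w =>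
  ind ((a ^+ 2 + b ^+ 2 + w < S) && (a ^+ 2 + b ^+ 2 + w + 2 * (rho * a) + csq u < S))%R)) (- (rho / 2))%R); [|sideT|sideT].
apply: eq_intR => a; apply: eq_intR => b; apply: eq_simplex_int => w.
congr ind; rewrite rho2.
have r0 : (0 <= rho)%R by rewrite sqrtr_ge0.
clearbody rho.
apply/idP/idP.
  by case: (leP 0%R a) => a0 /andP[h1 h2]; [rewrite ger0_norm//|rewrite ltr0_norm//]; nra.
by case: (leP 0%R a) => a0; [rewrite ger0_norm//|rewrite ltr0_norm//] => h; apply/andP; split; nra.
Qed.

(* The Gamma(n+1) tail probability at [4 t^2]. *)
Definition gamma_tail (t : R) : \bar R :=
  \intR_ q (ind (0 < q)%R * (ind (t < Num.sqrt q / 2)%R * (q ^+ n / n`!%:R * expR (- q))%:E)).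

Lemma gamma_tail_ge0 t : 0 <= gamma_tail t.
Proof. by rewrite /gamma_tail; sideT. Qed.

Lemma measurable_gamma_tail : measurable_fun setT gamma_tail.
Proof. by rewrite /gamma_tail; sideT. Qed.

Let gt0 := gamma_tail_ge0.
Let mgt := measurable_gamma_tail.

(** For $q$ with the Gamma law of parameter $n+1$, the mean of $\int_0^{\sqrt q/2}f$ is the integral
    of $f(t)$ times the probability of $\sqrt q/2>t$. *)
Lemma gamma_tail_swap (f : R -> \bar R) : measurable_fun setT f -> (forall t, 0 <= f t) ->
  \intR_ t (ind (0 < t)%R * (f t * gamma_tail t)) =
  simplex_int n.+1 (fun q => (expR (- q))%:E *
    \intR_ t (ind ((0 < t) && (t < Num.sqrt q / 2))%R * f t)).
Proof.
move=> mf f0; rewrite simplex_int_density; [|sideT|sideT].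
transitivity (\intR_ t \intR_ q (ind (0 < t)%R * (f t * (ind (0 < q)%R *
  (ind (t < Num.sqrt q / 2)%R * (q ^+ n / n`!%:R * expR (- q))%:E))))).
  apply: eq_intR => t; rewrite -intR_Zl; [|sideT|sideT|sideT].
  by rewrite -intR_Zl; [|sideT|sideT|sideT].
rewrite (intR_swap (f := fun t q => (ind (0 < t)%R * (f t * (ind (0 < q)%R *
  (ind (t < Num.sqrt q / 2)%R * (q ^+ n / n`!%:R * expR (- q))%:E)))))); [|sideT|sideT].
apply: eq_intR => q.
transitivity ((ind (0 < q)%R * ((q ^+ n / n`!%:R)%:E * (expR (- q))%:E)) *
    \intR_ t (ind ((0 < t) && (t < Num.sqrt q / 2))%R * f t)); last by rewrite -!muleA.
rewrite -intR_Zl; [|sideT|sideT|sideT].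
by apply: eq_intR => t; rewrite ind_and EFinM; mule_ac.
Qed.

(** For every $u$ the ball splits into an overlap and a slab; this splitting is averaged with the
    weight $e^{-|u|^2}$ of total mass $\pi^{n+1}$. Under the normalized weight $|u|^2$ has the Gamma
    law of parameter $n+1$, which is how [gamma_tail] enters. *)
Lemma ball_overlap_identity (S : R) :
  (pi ^+ n.+1)%:E * \int[mu_CD n.+1]_p ind (csq p < S)%R =
  \int[mu_CD n.+1]_x \int[mu_CD n.+1]_y (ind (csq x < S)%R * (ind (csq y < S)%R *
     (expR (- (csq x + csq y - 2 * cip x y)))%:E)) +
  (pi ^+ n.+1 * pi ^+ n * 2)%:E *
  \intR_ t (ind (0 < t)%R * (slice_vol (S - t ^+ 2)%R * gamma_tail t)).
Proof.
have expE : \int[mu_CD n.+1]_u (expR (- csq u))%:E = (@pi R ^+ n.+1)%:E.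
  rewrite (int_CD_sq n (g := fun q => (expR (- q))%:E)); [|sideT|sideT].
  rewrite (_ : simplex_int _ _ = 1) ?mule1//.
  transitivity (simplex_int n.+1 (fun w => (expR (- (0 + w)))%:E) : \bar R).
    by apply: eq_simplex_int => w; rewrite add0r.
  by rewrite simplex_int_expR oppr0 expR0.
pose vol := \int[mu_CD n.+1]_p ind (csq p < S)%R.
have vol0 : 0 <= vol by rewrite /vol; sideT.
pose inn u := \int[mu_CD n.+1]_x ind ((csq x < S) && (csq x + 2 * cip u x + csq u < S))%R.
have inn0 u : 0 <= inn u by rewrite /inn; sideT.
have minn : measurable_fun setT inn by rewrite /inn; sideT.
pose cap q := \intR_ t (ind ((0 < t) && (t < Num.sqrt q / 2))%R * slice_vol (S - t ^+ 2)%R).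
have cap0 u : 0 <= cap u by rewrite /cap; sideT.
have mcap : measurable_fun setT cap by rewrite /cap; sideT.
have splitE u : vol = inn u + (pi ^+ n)%:E * (2%:E * cap (csq u)).
  rewrite /inn int_ball_overlap /vol int_ball_sym.
  rewrite -ge0_muleDr; [|sideT|sideT]; congr_mule.
  rewrite -ge0_muleDr; [|sideT|sideT]; congr_mule.
  (* [cap] stops strictly below $|u|/2$, while the complement of the overlap range contains that
     endpoint; one point is negligible. *)
  rewrite /cap -intR_ind_le; [|sideT].
  rewrite -intR_D; [|sideT|sideT|sideT|sideT].
  apply: eq_intR => t; rewrite -ge0_muleDl; [|sideT|sideT].
  have r0 : (0 <= Num.sqrt (csq u) / 2)%R by rewrite divr_ge0.
  congr (_ * _); rewrite /ind -EFinD -natrD; congr (_%:R%:E).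
  case: (leP t 0%R) => h /=.
    by rewrite ltNge (le_trans h r0).
  by case: leP.
pose E2 := \int[mu_CD n.+1]_u ((expR (- csq u))%:E * ((pi ^+ n)%:E * (2%:E * cap (csq u)))).
transitivity (\int[mu_CD n.+1]_u ((expR (- csq u))%:E * inn u) + E2).
  rewrite -/vol -expE -ge0_integralZr; [|exact: measurableT|sideT|sideT|done].
  rewrite -ge0_integralD; [|exact: measurableT|sideT|sideT|sideT|sideT].
  apply: eq_integral => u _; rewrite -ge0_muleDr; [|sideT|sideT].
  by rewrite -splitE.
congr (_ + _).
  transitivity (\int[mu_CD n.+1]_u \int[mu_CD n.+1]_x (ind (csq x < S)%R *
     (ind (csq x + 2 * cip u x + csq u < S)%R * (expR (- csq u))%:E))).
    apply: eq_integral => u _; rewrite -ge0_integralZl; [|exact: measurableT|sideT|sideT|sideT].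
    by apply: eq_integral => x _; rewrite ind_and; mule_ac.
  rewrite (fubini_tonelli (fun z => ind (csq z.2 < S)%R *
     (ind (csq z.2 + 2 * cip z.1 z.2 + csq z.1 < S)%R * (expR (- csq z.1))%:E))); [|sideT|sideT].
  apply: eq_integral => x _.
  rewrite -(int_CD_shift x (f := fun y => ind (csq x < S)%R * (ind (csq y < S)%R *
     (expR (- (csq x + csq y - 2 * cip x y)))%:E))); [|sideT|sideT].
  apply: eq_integral => u _ /=; congr_mule.
  rewrite csq_cadd cip_cadd cipC; congr (_ * (expR _)%:E).
  by rewrite cipC; ring.
rewrite /E2 (int_CD_sq n (g := fun q => (expR (- q))%:E * ((pi ^+ n)%:E * (2%:E * cap q)))); [|sideT|sideT].
rewrite (gamma_tail_swap (f := fun t => slice_vol (S - t ^+ 2)%R)); [|sideT|sideT].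
rewrite EFinM EFinM -!muleA; congr_mule.
rewrite !simplex_int_density; [|sideT..].
rewrite -intR_Zl; [|sideT|sideT|sideT].
rewrite -intR_Zl; [|sideT|sideT|sideT].
by apply: eq_intR => q; mule_ac.
Qed.

End BallOverlap.

(** * Intensities of the point process *)

Lemma det_mx2 (K : comNzRingType) (M : 'M[K]_2) :
  \det M = M 0 0 * M 1 1 - M 0 1 * M 1 0.
Proof.
rewrite (expand_det_row _ ord0) !big_ord_recl big_ord0 /cofactor !det_mx11 !mxE /=.
rewrite expr0 expr1 addr0 mul1r mulN1r mulrN.
by congr (M _ _ * M _ _ - M _ _ * M _ _); apply/val_inj.
Qed.

Lemma measurable_mem_comp d1 d2 (T1 : measurableType d1) (T2 : measurableType d2)
  (A : set T2) (f : T1 -> T2) : measurable A -> measurable_fun setT f ->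
  measurable_fun setT (fun x => f x \in A).
Proof.
move=> mA mf; apply: (measurable_fun_bool true).
rewrite (_ : _ `&` _ = setT `&` f @^-1` A); first exact: mf.
congr (_ `&` _); apply/seteqP; split => x /=; first by move/set_mem.
by move/mem_set.
Qed.

Ltac measT_ext ::=
  lazymatch goal with
  | |- measurable_fun _ (fun x => simplex_int _ _) =>
      apply: measurable_simplex_int; [measT|]
  | |- measurable_fun _ (fun x => csq _) => apply: measurable_csq; measT
  | |- measurable_fun _ (fun x => cip _ _) => apply: measurable_cip; measT
  | |- measurable_fun _ (fun x => cadd _ _) => apply: measurable_cadd; measT
  | |- measurable_fun _ (fun x => in_mem _ _) =>
      apply: measurable_mem_comp; [assumption|measT]
  end.

Section Kernel.
Context {R : realType} {D : nat}.
Implicit Types x y : CD R D.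

Lemma cnorm_sqr x : cnorm x ^+ 2 = csq x.
Proof. by rewrite sqr_sqrtr// csq_ge0. Qed.

Lemma ballCE (r : R) x : 0 < r -> (ballC D r x) = (csq x < r ^+ 2) :> Prop.
Proof.
move=> r0; rewrite /ballC /= -cnorm_sqr; apply/propext.
by rewrite ltr_sqr// nnegrE ?sqrtr_ge0 ?ltW.
Qed.

Lemma cdotE x y : cdot x y = Complex (cip x y)
  (\sum_(l < D) ((tnth x l).2 * (tnth y l).1 - (tnth x l).1 * (tnth y l).2)).
Proof.
rewrite /cdot /cip.
elim/big_rec3: _ => // l u v w _ ->.
rewrite /Defs.coord; case: (tnth x l) (tnth y l) => [a b] [c d].
by apply/eqP; rewrite eq_complex /=; apply/andP; split; apply/eqP; ring.
Qed.

Lemma KH_diag x : KH x x = Complex (expR (csq x)) 0.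
Proof.
rewrite /KH cdotE big1 => [|l _]; last by rewrite mulrC subrr.
rewrite /expC /= cos0 sin0 mulr1 mulr0; by congr (Complex (expR _) _).
Qed.

(** The imaginary part of [cdot] is antisymmetric, so the phases cancel and the product is
    $|K(x,y)|^2$. *)
Lemma KH_mulC x y : complex.Re (KH x y * KH y x) = expR (2 * cip x y).
Proof.
rewrite /KH !cdotE (cipC y x).
set s := \sum_(l < D) _; set t := \sum_(l < D) _.
have -> : t = - s.
  by rewrite /t /s -sumrN; apply: eq_bigr => l _; ring.
rewrite /expC /= cosN sinN mulr_natl mulr2n expRD.
set e := expR _; have := cos2Dsin2 s; set c := cos s; set d := sin s => h.
transitivity (e * e * (c ^+ 2 + d ^+ 2)); first by ring.
by rewrite h mulr1.
Qed.

Lemma det_KH1 x : complex.Re (\det (\matrix_(i < 1, j < 1)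
  KH (tnth [tuple x] i) (tnth [tuple x] j))) = expR (csq x).
Proof. by rewrite det_mx11 mxE KH_diag. Qed.

Lemma det_KH2 x y : complex.Re (\det (\matrix_(i < 2, j < 2)
  KH (tnth [tuple x; y] i) (tnth [tuple x; y] j))) =
  expR (csq x + csq y) - expR (2 * cip x y).
Proof.
rewrite det_mx2 !mxE.
have -> : tnth [tuple x; y] 0 = x by [].
have -> : tnth [tuple x; y] 1 = y by [].
have ReB (a b : R[i]) : complex.Re (a - b) = complex.Re a - complex.Re b.
  by case: a b => ? ? [].
rewrite ReB KH_mulC !KH_diag; congr (_ - _).
by rewrite /= !mulr0 subr0 expRD.
Qed.

(** The two-point intensity with respect to Lebesgue measure; the exponent is $-|x-y|^2$. *)
Definition pair_density x y : R :=
  (pi ^+ D)^-1 ^+ 2 * (1 - expR (- (csq x + csq y - 2 * cip x y))).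

Lemma csq_dist_ge0 x y : 0 <= csq x + csq y - 2 * cip x y.
Proof.
rewrite /csq /cip mulr_sumr -big_split /= -sumrB; apply: sumr_ge0 => l _.
have -> : forall a b c d : R, a ^+ 2 + b ^+ 2 + (c ^+ 2 + d ^+ 2) - 2 * (a * c + b * d)
  = (a - c) ^+ 2 + (b - d) ^+ 2 by move=> *; ring.
by rewrite addr_ge0 ?sqr_ge0.
Qed.

Lemma pair_density_ge0 x y : 0 <= pair_density x y.
Proof.
rewrite /pair_density mulr_ge0 ?sqr_ge0// subr_ge0.
by rewrite -[X in _ <= X]expR0 ler_expR oppr_le0 csq_dist_ge0.
Qed.

Lemma pair_density_diag x : pair_density x x = 0.
Proof.
have -> : pair_density x x = (pi ^+ D)^-1 ^+ 2 * (1 - expR (- (csq x + csq x - 2 * csq x))).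
  by congr (_ * (1 - expR (- (_ - 2 * _)))); apply: eq_bigr => l _; rewrite !expr2.
by rewrite (_ : csq x + csq x - 2 * csq x = 0) ?oppr0 ?expR0 ?subrr ?mulr0//; ring.
Qed.

Lemma det_density2 x y :
  complex.Re (\det (\matrix_(i < 2, j < 2)
  KH (tnth [tuple x; y] i) (tnth [tuple x; y] j))) *
  \prod_(i < 2) lambda_density (tnth [tuple x; y] i) = pair_density x y.
Proof.
rewrite det_KH2 !big_ord_recl big_ord0 !tnth0 !(tnth_nth x) /= mulr1.
rewrite /lambda_density !cnorm_sqr /pair_density.
have -> : - (csq x + csq y - 2 * cip x y) = 2 * cip x y - csq x - csq y by ring.
rewrite !expRD !expRN.
have h := expR_gt0 (csq x); have h' := expR_gt0 (csq y).
field.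
by rewrite !gt_eqF// exprn_gt0// pi_gt0.
Qed.

End Kernel.

Section Correlation.
Context {R : realType} {D : nat}.
Context d (Omega : measurableType d) (P : probability Omega R).
Variable (Xi : Omega -> set (CD R D)).
Hypothesis HXi : is_DPP P Xi (@KH R D).
Local Open Scope ereal_scope.

(** The diagonal value $e^{|x|^2}$ of the kernel cancels the Gaussian reference density, which
    leaves the constant intensity $\pi^{-D}$. *)
Lemma mean_npoints (A : set (CD R D)) : measurable A ->
  \int[P]_w npoints (Xi w) A =
  ((pi ^+ D)^-1)%:E * \int[mu_CD D]_x ind (x \in A).
Proof.
move=> mA; have [_ H] := HXi.
have := H 1%N (fun=> A) (fun=> mA).
under eq_integral do rewrite big_ord_recl big_ord0 mule1.
move=> -> ; last by move=> i j; rewrite !ord1 eqxx.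
transitivity (leb_int_CD D (fun x : CD R D => ((pi ^+ D)^-1)%:E * ind (x \in A))).
  congr leb_int_CD; apply/funext => x /=.
  rewrite det_KH1 big_ord_recl big_ord0 tnth0 mulr1 /lambda_density cnorm_sqr.
  rewrite indicE /ind -EFinM; congr EFin.
  have -> : ([tuple x] \in [set xs' : 1.-tuple (CD R D) | forall i, A (tnth xs' i)]) = (x \in A).
    apply/idP/idP => /set_mem /= h; apply/mem_set => /=; first by move: (h ord0); rewrite tnth0.
    by move=> i; rewrite ord1 tnth0.
  have -> : forall a b c e : R, (a * b * (c * e) = c * a * (b * e))%R by move=> *; ring.
  by rewrite -expRD subrr expR0 mulr1.
have pi0 : (0 <= (@pi R ^+ D)^-1)%R by rewrite invr_ge0 exprn_ge0// pi_ge0.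
rewrite leb_int_CDE; [|sideT|sideT].
by rewrite ge0_integralZl; [|exact: measurableT|sideT|sideT|sideT].
Qed.

Lemma measurable_pair_density :
  measurable_fun setT (fun z : CD R D * CD R D => pair_density z.1 z.2).
Proof. by rewrite /pair_density; measT. Qed.

Lemma pair_npoints (A B : set (CD R D)) : measurable A -> measurable B ->
  A `&` B = set0 ->
  \int[P]_w (npoints (Xi w) A * npoints (Xi w) B) =
  \int[mu_CD D]_x \int[mu_CD D]_y
    (ind (x \in A) * (ind (y \in B) * (pair_density x y)%:E)).
Proof.
move=> mA mB AB; have [_ H] := HXi.
pose C (i : 'I_2) := if i == ord0 then A else B.
have mC i : measurable (C i) by rewrite /C; case: ifP.
have := H 2%N C mC.
under eq_integral do rewrite 2!big_ord_recl big_ord0 mule1 /C /=.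
move=> -> ; last first.
  by case=> [[|[|//]] i]; case=> [[|[|//]] j] //= _; rewrite /C//= setIC.
have mp := @measurable_pair_density.
have pd0 := @pair_density_ge0 R D.
pose f x y := ind (x \in A) * (ind (y \in B) * (pair_density x y)%:E).
have mf : measurable_fun setT (fun z : CD R D * CD R D => f z.1 z.2).
  by rewrite /f; sideT.
have f0 x y : 0 <= f x y by rewrite /f !mule_ge0 ?ind_ge0// lee_fin.
transitivity (leb_int_CD D (fun x => leb_int_CD D (fun y => f x y))).
  congr leb_int_CD; apply/funext => x /=; congr leb_int_CD; apply/funext => y /=.
  rewrite -mulrA det_density2 /f /ind indicE -!EFinM mulrA -natrM mulnb.
  congr (_%:R * _)%:E.
  congr nat_of_bool; apply/idP/idP => [/set_mem /= h|/andP[/set_mem h1 /set_mem h2]].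
    apply/andP; split; apply/mem_set.
      by move: (h ord0); rewrite tnth0.
    by move: (h ord_max); rewrite (tnth_nth x).
  apply/mem_set => /= -[[|[|//]]] i; rewrite /C (tnth_nth x) //=.
under [X in leb_int_CD D X]eq_fun => x.
  have mfx : measurable_fun setT (f x) by rewrite /f; sideT.
  rewrite leb_int_CDE; [|exact: mfx|by []].
  over.
rewrite leb_int_CDE//.
- exact: measurable_section_int.
- by move=> x; apply: integral_ge0.
Qed.

End Correlation.

(** Monotone convergence in the form needed for refining partitions: at each point the sequence is
    constant as soon as the partition is fine enough. *)
Lemma cvg_integral_stationary d (T : measurableType d) (R : realType)
  (mu : {measure set T -> \bar R}) (g : nat -> T -> \bar R) (f : T -> \bar R) :
  (forall m, measurable_fun setT (g m)) -> (forall m x, 0 <= g m x)%E ->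
  (forall x m k, (m <= k)%N -> (g m x <= g k x)%E) ->
  (forall x, exists M, forall m, (M <= m)%N -> g m x = f x) ->
  (\int[mu]_x g m x)%E @[m --> \oo] --> (\int[mu]_x f x)%E.
Proof.
move=> mg g0 ndg gf.
have -> : (\int[mu]_x f x = \int[mu]_x limn (g^~ x))%E.
  apply: eq_integral => x _; apply/esym/cvg_lim => //.
  apply: cvg_near_cst; have [M hM] := gf x.
  by exists M => // m /= Mm; exact: hM.
apply: cvg_monotone_convergence => //.
by move=> x _ m k; exact: ndg.
Qed.

(** * Factorial second moment *)

Section Separation.
Context {R : realType} {D : nat}.
Implicit Types x y : CD R D.

(* Countably many half-spaces with rational boundary, numbered by pickle, separate the points of C^D. *)
Definition halfspace (j : nat) x : bool :=
  if unpickle j is Some t then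
    let: (l, b, q) := t : 'I_D * bool * rat in
    (if b then (tnth x l).1 else (tnth x l).2) < ratr q
  else false.

Lemma measurable_halfspace j : measurable_fun setT (halfspace j).
Proof.
rewrite /halfspace; case: (unpickle j) => [[[l [] q]]|]; last exact: measurable_cst.
  by measT.
by measT.
Qed.

Lemma halfspace_neq x y : x != y -> exists j, halfspace j x != halfspace j y.
Proof.
move=> xy.
have sep (a b : R) : a != b -> exists q : rat, (a < ratr q) != (b < ratr q).
  wlog ab : a b / a < b.
    move=> h; rewrite neq_lt => /orP[ab|ba]; first by apply: h => //; rewrite lt_eqF.
    have hba : b != a by rewrite lt_eqF.
    by have [q hq] := h b a ba hba; exists q; rewrite eq_sym.
  move=> _; have [q] := rat_in_itvoo ab; rewrite in_itv/= => /andP[aq qb].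
  by exists q; rewrite aq ltNge (ltW qb).
have [l hl] : exists l, tnth x l != tnth y l.
  apply/existsP; apply: contraNT xy; rewrite negb_exists => /forallP h.
  by apply/eqP/eq_from_tnth => i; apply/eqP; move: (h i); rewrite negbK.
have [h1|h1] := eqVneq (tnth x l).1 (tnth y l).1.
  have h2 : (tnth x l).2 != (tnth y l).2.
    apply: contraNN hl => /eqP h2; apply/eqP.
    by case: (tnth x l) (tnth y l) h1 h2 => [? ?] [? ?] /= -> ->.
  have [q hq] := sep _ _ h2; exists (pickle (l, false, q)).
  by rewrite /halfspace pickleK.
have [q hq] := sep _ _ h1; exists (pickle (l, true, q)).
by rewrite /halfspace pickleK.
Qed.

(** The bits label a cell of a partition into at most $2^m$ pieces, and each further bit refines
    it. *)
Definition code (m : nat) x : m.-tuple bool := [tuple halfspace i x | i < m].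

Lemma code_eqP m x y :
  reflect (forall i, (i < m)%N -> halfspace i x = halfspace i y) (code m x == code m y).
Proof.
apply: (iffP eqP) => [h i im|h].
  have := congr1 (fun t => tnth t (Ordinal im)) h.
  by rewrite !tnth_mktuple.
by apply: eq_from_tnth => i; rewrite !tnth_mktuple; exact: h.
Qed.

Lemma code_neq_leq m k x y : (m <= k)%N -> code m x != code m y -> code k x != code k y.
Proof.
move=> mk; apply: contraNN => /code_eqP h; apply/code_eqP => i im.
by apply: h; exact: leq_trans im mk.
Qed.

Lemma code_neq_near x y : x != y ->
  exists M, forall m, (M <= m)%N -> code m x != code m y.
Proof.
move=> /halfspace_neq[j hj]; exists j.+1 => m jm; apply/negP => /code_eqP h.
by move: hj; rewrite h ?eqxx.
Qed.

Variable Lam : set (CD R D).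

Definition cell m (c : m.-tuple bool) : set (CD R D) :=
  Lam `&` [set x | code m x == c].

Lemma measurable_code_eq m (c : m.-tuple bool) :
  measurable_fun setT (fun x => code m x == c).
Proof.
apply: (measurable_fun_bool true).
rewrite (_ : _ `&` _ = \bigcap_(i in [set: 'I_m]) [set x | halfspace i x == tnth c i]).
  apply: fin_bigcap_measurable => // i _.
  rewrite -[X in measurable X]setTI.
  have -> : [set x | halfspace i x == tnth c i] = halfspace i @^-1` [set tnth c i].
    by apply/seteqP; split => x /= /eqP.
  exact: measurable_halfspace.
apply/seteqP; split => x /=.
  by move=> [_ /eqP <-] i _ /=; rewrite tnth_mktuple.
move=> h; split => //; apply/eqP/eq_from_tnth => i; rewrite tnth_mktuple.
by apply/eqP; exact: h.
Qed.

Lemma measurable_cell m (c : m.-tuple bool) : measurable Lam -> measurable (cell c).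
Proof.
move=> mL; apply: measurableI => //.
rewrite -[X in measurable X]setTI.
rewrite (_ : [set x | code m x == c] = (fun x => code m x == c) @^-1` [set true])//.
exact: measurable_code_eq.
Qed.

Lemma in_cell m (c : m.-tuple bool) x : (x \in cell c) = (x \in Lam) && (code m x == c).
Proof. by rewrite in_setI; congr (_ && _); rewrite mem_setE /= . Qed.

Lemma cell_disjoint m (c c' : m.-tuple bool) : c != c' -> cell c `&` cell c' = set0.
Proof.
move=> cc; apply/seteqP; split => x //= [[_ /= /eqP h] [_ /= /eqP h']].
by move: cc; rewrite -h -h' eqxx.
Qed.

(** Only the pair of cells that contain [x] and [y] contributes. The identity is applied twice: to
    the points of the configuration and to the domain of integration of the pair density. *)
Lemma sum_cell m x y :
  (\sum_(p : m.-tuple bool * m.-tuple bool)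
     (p.1 != p.2) * ((x \in cell p.1) * (y \in cell p.2)) =
   [&& x \in Lam, y \in Lam & code m x != code m y])%N.
Proof.
rewrite (bigD1 (code m x, code m y))//= big1 ?addn0; last first.
  move=> [c c'] /= h; rewrite !in_cell.
  have : ~~ ((code m x == c) && (code m y == c')).
    apply: contraNN h => /andP[/eqP -> /eqP ->]; exact: eqxx.
  by case: (code m x == c); case: (code m y == c') => //= _; rewrite ?andbF ?muln0.
rewrite !in_cell !eqxx !andbT.
by case: (x \in Lam); case: (y \in Lam); case: (code m x != code m y).
Qed.

End Separation.

Section PairCount.
Context {R : realType} {D : nat}.
Context d (Omega : measurableType d) (P : probability Omega R).
Variable (Xi : Omega -> set (CD R D)).
Hypothesis HXi : is_DPP P Xi (@KH R D).
Variables (Lam : set (CD R D)).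
Hypotheses (mLam : measurable Lam) (fLam : forall w, finite_set (Xi w `&` Lam)).

Let L w : seq (CD R D) := finmap.enum_fset (fset_set (Xi w `&` Lam)).
Definition npt w : nat := size (L w).

Lemma npoints_subE w (A : set (CD R D)) : A `<=` Lam ->
  npoints (Xi w) A = ((\sum_(x <- L w) (x \in A))%N%:R)%:E.
Proof.
move=> AL; rewrite /npoints.
have -> : Xi w `&` A = (Xi w `&` Lam) `&` A by rewrite -setIA (setIidr AL).
rewrite esum_mkcondr esum_fset//; last by move=> x _; case: ifP.
rewrite fsbig_finite// natr_sum -sumEFin; apply: eq_bigr => x _.
by case: ifP.
Qed.

Lemma in_L w x : x \in L w -> x \in Lam.
Proof. by rewrite /L in_fset_set// => /set_mem [_ h]; exact: mem_set. Qed.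

Lemma nptE w : npoints (Xi w) Lam = (npt w)%:R%:E.
Proof.
rewrite npoints_subE//; congr (_%:R%:E); rewrite /npt -sum1_size.
by rewrite [LHS]big_seq [RHS]big_seq; apply: eq_bigr => x /in_L ->.
Qed.

Local Open Scope ereal_scope.

(** The number of ordered pairs of points lying in different cells: the part of $N(N-1)$ that
    correlations on disjoint sets can reach. *)
Let offdiag m w : \bar R := \sum_(p : m.-tuple bool * m.-tuple bool)
  (ind (p.1 != p.2) * (npoints (Xi w) (cell Lam p.1) * npoints (Xi w) (cell Lam p.2))).

Let offdiagE m w : offdiag m w =
  (\sum_(x <- L w) \sum_(y <- L w) (code m x != code m y))%N%:R%:E.
Proof.
have cL (c : m.-tuple bool) : cell Lam c `<=` Lam by move=> x [].
transitivity (((\sum_(p : m.-tuple bool * m.-tuple bool)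
   \sum_(x <- L w) \sum_(y <- L w)
   (p.1 != p.2) * ((x \in cell Lam p.1) * (y \in cell Lam p.2)))%N)%:R%:E : \bar R).
  rewrite /offdiag natr_sum -sumEFin; apply: eq_bigr => p _.
  rewrite !npoints_subE// /ind -!EFinM -!natrM; congr (_%:R%:E).
  rewrite big_distrlr /= big_distrr /=; apply: eq_bigr => x _.
  by rewrite big_distrr.
congr (_%:R%:E); rewrite exchange_big /= big_seq [RHS]big_seq; apply: eq_bigr => x xL.
rewrite exchange_big /= big_seq [RHS]big_seq; apply: eq_bigr => y yL.
by rewrite sum_cell (in_L xL) (in_L yL).
Qed.

Let offdiag_cvg w : exists M, forall m, (M <= m)%N ->
  offdiag m w = (npt w * (npt w).-1)%N%:R%:E.
Proof.
(* [k] selects a separating level for each pair; on the diagonal the condition is void. The maximum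
   of [k] over the finite configuration then separates all its points. *)
have /boolp.choice[k hk] : forall z : CD R D * CD R D, exists M,
    z.1 != z.2 -> forall m, (M <= m)%N -> code m z.1 != code m z.2.
  move=> [x y]; have [->|xy] := eqVneq x y; first by exists 0%N => /= /eqP [].
  by have [M hM] := code_neq_near xy; exists M.
exists (\max_(x <- L w) \max_(y <- L w) k (x, y))%N => m hm.
rewrite offdiagE; congr (_%:R%:E).
transitivity (\sum_(x <- L w) (npt w).-1)%N; last first.
  by rewrite big_const_seq count_predT iter_addn_0 mulnC.
rewrite big_seq [RHS]big_seq; apply: eq_bigr => x xL.
transitivity (\sum_(y <- L w | y != x) 1)%N.
  rewrite [RHS]big_mkcond /= big_seq [RHS]big_seq; apply: eq_bigr => y yL.
  have [->|yx] := eqVneq y x; first by rewrite eqxx.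
  rewrite (hk (x, y)) //=; first by rewrite eq_sym.
  apply: leq_trans hm.
  apply: leq_trans (leq_bigmax_seq _ _ _) => //=; last first.
    exact: xL.
  exact: leq_bigmax_seq.
rewrite sum1_count.
have := count_predC (pred1 x) (L w).
rewrite count_uniq_mem ?xL; last exact: finmap.fset_uniq.
by rewrite /npt => <-; rewrite add1n.
Qed.

Lemma integral_npt_pairs :
  \int[P]_w (npt w * (npt w).-1)%N%:R%:E =
  \int[mu_CD D]_x \int[mu_CD D]_y
    (ind (x \in Lam) * (ind (y \in Lam) * (pair_density x y)%:E)).
Proof.
have [[_ mN] _] := HXi.
have mcell m (c : m.-tuple bool) : measurable (cell Lam c) by exact: measurable_cell.
have mpd := @measurable_pair_density R D.
have pd0 := @pair_density_ge0 R D.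
pose F m (z : CD R D * CD R D) : \bar R :=
  ind [&& z.1 \in Lam, z.2 \in Lam & code m z.1 != code m z.2] * (pair_density z.1 z.2)%:E.
pose Fp m (p : m.-tuple bool * m.-tuple bool) x y : \bar R :=
  ind (p.1 != p.2) * (ind (x \in cell Lam p.1) *
    (ind (y \in cell Lam p.2) * (pair_density x y)%:E)).
have N0 w A : 0 <= npoints (Xi w) A by rewrite /npoints; exact: esum_ge0.
have Fp0 m p x y : 0 <= Fp m p x y by rewrite /Fp !mule_ge0 ?ind_ge0 ?lee_fin.
have mFp m p : measurable_fun setT (fun z : CD R D * CD R D => Fp m p z.1 z.2).
  by have mc1 := mcell m p.1; have mc2 := mcell m p.2; rewrite /Fp; sideT.
have FE m z : F m z = \sum_p Fp m p z.1 z.2.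
  rewrite /F /ind -sum_cell natr_sum -sumEFin ge0_sume_distrl; last first.
    by move=> p _; rewrite lee_fin.
  apply: eq_bigr => p _; rewrite /Fp /ind -!EFinM; congr EFin.
  by rewrite !natrM !mulrA.
have mF m : measurable_fun setT (F m).
  rewrite (_ : F m = fun z => \sum_p Fp m p z.1 z.2); last by apply/funext => z.
  by apply: emeasurable_sum => p; exact: mFp.
have F0 m z : 0 <= F m z by rewrite /F mule_ge0 ?ind_ge0 ?lee_fin.
have offE m : \int[P]_w offdiag m w = \int[mu_CD D \x mu_CD D]_z F m z.
  rewrite ge0_integral_sum//; last first.
  - by move=> p w _; rewrite mule_ge0 ?ind_ge0// mule_ge0.
  - by move=> p; have := mN _ (mcell m p.1); have := mN _ (mcell m p.2) => h1 h2;
      apply: emeasurable_funM; [measT|exact: emeasurable_funM].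
  under [RHS]eq_integral do rewrite FE.
  rewrite ge0_integral_sum//.
  apply: eq_bigr => p _.
  rewrite (fubini_tonelli1 (fun z => Fp m p z.1 z.2))//.
  have [pp|pp] := eqVneq p.1 p.2.
    rewrite integral0_eq; last by move=> w _; rewrite /ind mul0e.
    rewrite integral0_eq// => x _; apply: integral0_eq => y _.
    by rewrite /Fp pp /ind eqxx mul0e.
  transitivity (\int[P]_w (npoints (Xi w) (cell Lam p.1) * npoints (Xi w) (cell Lam p.2))).
    by apply: eq_integral => w _; rewrite /ind mul1e.
  rewrite (pair_npoints HXi (mcell m p.1) (mcell m p.2) (@cell_disjoint R D Lam m _ _ pp)).
  by apply: eq_integral => x _; apply: eq_integral => y _; rewrite /Fp pp /ind mul1e.
pose G (z : CD R D * CD R D) : \bar R :=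
  ind (z.1 \in Lam) * (ind (z.2 \in Lam) * (pair_density z.1 z.2)%:E).
transitivity (\int[mu_CD D \x mu_CD D]_z G z); last first.
  rewrite (fubini_tonelli1 G)//; first by rewrite /G; sideT.
  by move=> z; rewrite /G !mule_ge0 ?ind_ge0 ?lee_fin.
(* By [offE] the sequences in [c1] and [c2] coincide, so their two limits agree. *)
have c1 : \int[P]_w offdiag m w @[m --> \oo] --> \int[P]_w (npt w * (npt w).-1)%N%:R%:E.
  apply: cvg_integral_stationary => //.
  - move=> m; apply: emeasurable_sum => p; apply: emeasurable_funM; first by measT.
    by apply: emeasurable_funM; apply: mN.
  - by move=> m w; rewrite offdiagE lee_fin.
  - move=> w m k mk; rewrite !offdiagE lee_fin ler_nat.
    apply: leq_sum => x _; apply: leq_sum => y _.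
    by have := @code_neq_leq R D m k x y mk; case: (code m x != _) => // ->.
have c2 : \int[mu_CD D \x mu_CD D]_z F m z @[m --> \oo] --> \int[mu_CD D \x mu_CD D]_z G z.
  apply: cvg_integral_stationary => //.
  - move=> z m k mk; rewrite /F lee_wpmul2r ?lee_fin// ler_nat.
    have := @code_neq_leq R D m k z.1 z.2 mk.
    by case: (z.1 \in Lam); case: (z.2 \in Lam) => //=; case: (code m _ != _) => // ->.
  (* Diagonal pairs never lie in distinct cells; the limit is still right there because the pair
     density vanishes. *)
  - move=> [x y]; have [->|xy] := eqVneq x y.
      by exists 0%N => m _; rewrite /F /G /= pair_density_diag !mule0.
    have [M hM] := code_neq_near xy; exists M => m Mm.
    by rewrite /F /G /= hM// andbT ind_and muleA.
have -> : \int[P]_w (npt w * (npt w).-1)%N%:R%:E = limn (fun m => \int[P]_w offdiag m w).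
  by apply/esym/cvg_lim.
by under eq_fun do rewrite offE; apply/cvg_lim.
Qed.

End PairCount.

(** The source of finiteness for the variance: nonnegative terms with a finite sum are finite, so
    identities in [\bar R] become real ones in which subtraction is allowed. *)
Lemma adde_eq_EFin (R : realType) (x y : \bar R) (r : R) :
  (0 <= x)%E -> (0 <= y)%E -> (x + y = r%:E)%E ->
  exists a b, [/\ x = a%:E, y = b%:E & a + b = r].
Proof.
by case: x y => [a| |] [b| |] // _ _; rewrite -EFinD => -[<-]; exists a, b.
Qed.

(** * Mean and variance of the number of points in a ball *)

Section CountMoments.
Context {R : realType} (n : nat).
Context d (Omega : measurableType d) (P : probability Omega R).
Variable (Xi : Omega -> set (CD R n.+1)).
Hypothesis HXi : is_DPP P Xi (@KH R n.+1).
Variable r : R.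
Hypothesis r0 : 0 < r.

Let Lam : set (CD R n.+1) := ballC n.+1 r.
Let S := r ^+ 2.

Let in_Lam x : (x \in Lam) = (csq x < S).
Proof.
by apply/idP/idP => [/set_mem|h]; rewrite /Lam ?ballCE//; apply/mem_set; rewrite ballCE.
Qed.

Let measurable_Lam : measurable Lam.
Proof.
rewrite -[X in measurable X]setTI (_ : Lam = (fun x => csq x < S) @^-1` [set true]).
  have : measurable_fun setT (fun x : CD R n.+1 => csq x < S) by measT.
  by apply.
by apply/seteqP; split => x /=; rewrite /Lam ballCE.
Qed.

Let finite_Lam w : finite_set (Xi w `&` Lam).
Proof. by have [[h _] _] := HXi; exact: h. Qed.

Local Open Scope ereal_scope.

Let vol := \int[mu_CD n.+1]_p ind (csq p < S)%R : \bar R.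

Let volE : vol = (pi ^+ n.+1 * (S ^+ n.+1 / n.+1`!%:R))%:E.
Proof.
rewrite /vol (int_CD_sq n (g := fun q => ind (q < S)%R)); [|sideT|sideT].
by rewrite simplex_int_ind exprn_gt0// /ind mul1e -EFinM.
Qed.

Let piX_neq0 m : (@pi R ^+ m != 0)%R.
Proof. by rewrite expf_neq0// gt_eqF// pi_gt0. Qed.

Let integral_count : \int[P]_w npoints (Xi w) Lam = (r ^+ (2 * n.+1) / n.+1`!%:R)%:E.
Proof.
rewrite (mean_npoints HXi)//.
under eq_integral do rewrite in_Lam.
by rewrite -/vol volE -EFinM mulKf// /S -exprM.
Qed.

Lemma mean_count_ball :
  mean_count P Xi (ballC n.+1 r) = (r ^+ (2 * n.+1) / n.+1`!%:R)%R.
Proof. by rewrite /mean_count integral_count. Qed.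

Lemma var_count_ball :
  (var_count P Xi (ballC n.+1 r))%:E =
  (2 / pi)%:E * \intR_ t (ind (0 < t)%R *
    (slice_vol n (r ^+ 2 - t ^+ 2)%R * gamma_tail n t)).
Proof.
rewrite /var_count mean_count_ball -/Lam; set e := (r ^+ (2 * n.+1) / n.+1`!%:R)%R.
have e0 : (0 <= e)%R by rewrite divr_ge0// exprn_ge0// ltW.
pose N w : R := (npt Xi Lam w)%:R%R.
have NE w : npoints (Xi w) Lam = (N w)%:E by rewrite nptE.
have mN : measurable_fun setT N.
  apply/measurable_EFinP; rewrite (_ : _ \o _ = fun w => npoints (Xi w) Lam).
    by have [[_ h] _] := HXi; exact: h.
  by apply/funext => w; rewrite NE.
have N0 w : (0 <= N w)%R by [].
have IN : \int[P]_w (N w)%:E = e%:E.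
  by rewrite -integral_count; apply: eq_integral => w _; rewrite NE.
set I := \int[P]_w ((N w - e) ^+ 2)%:E.
have -> : \int[P]_w (npoints (Xi w) Lam - e%:E) ^+ 2 = I.
  by apply: eq_integral => w _; rewrite NE -EFinB expe2 -EFinM -expr2.
pose Q := \int[P]_w ((N w) * (N w - 1))%:E.
have QE : Q = \int[P]_w (npt Xi Lam w * (npt Xi Lam w).-1)%N%:R%:E.
  apply: eq_integral => w _; congr EFin; rewrite natrM /N.
  by case: (npt Xi Lam w) => [|k]; rewrite ?mul0r// -natr1 addrK.
have NN1 w : (0 <= N w * (N w - 1))%R.
  rewrite /N; case: (npt Xi Lam w) => [|k]; first by rewrite mul0r.
  by rewrite -natr1 addrK mulr_ge0// -?natr1.
(* The integral of $(N-e)^2+2eN=N(N-1)+N+e^2$, arranged so that every term is nonnegative. *)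
have IQ : I + (2 * e * e)%:E = Q + e%:E + (e ^+ 2)%:E.
  have -> : (e ^+ 2)%:E = \int[P]_w (cst (e ^+ 2)%:E) w.
    transitivity ((e ^+ 2)%:E * P setT); first by rewrite probability_setT mule1.
    by rewrite integral_cst.
  rewrite EFinM -{1}IN -ge0_integralZl//; last 3 first.
  - by measT.
  - by move=> w _; rewrite lee_fin.
  - by rewrite lee_fin mulr_ge0.
  rewrite -IN /I /Q.
  rewrite -[LHS]ge0_integralD//; last 4 first.
  - by move=> w _; rewrite lee_fin sqr_ge0.
  - by measT.
  - by move=> w _; rewrite -EFinM lee_fin mulr_ge0// mulr_ge0.
  - by measT.
  rewrite -[X in X + _]ge0_integralD//; last 4 first.
  - by move=> w _; rewrite lee_fin.
  - by measT.
  - by move=> w _; rewrite lee_fin.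
  - by measT.
  rewrite -ge0_integralD; [|exact: measurableT|by move=> w _; rewrite adde_ge0// lee_fin
    |by apply: emeasurable_funD; measT|by move=> w _; rewrite lee_fin sqr_ge0|exact: measurable_cst].
  by apply: eq_integral => w _; rewrite /= -!EFinM -!EFinD; congr EFin; ring.
pose W := \int[mu_CD n.+1]_x \int[mu_CD n.+1]_y (ind (csq x < S)%R *
  (ind (csq y < S)%R * (expR (- (csq x + csq y - 2 * cip x y)))%:E)).
pose k := (((@pi R) ^+ n.+1)^-1 ^+ 2)%R.
have k0 : (0 <= k)%R by rewrite exprn_ge0// invr_ge0 exprn_ge0// pi_ge0.
have mpd := @measurable_pair_density R n.+1.
have pd0 := @pair_density_ge0 R n.+1.
(* Adding $k\,e^{-|x-y|^2}$ to the pair density leaves the constant $k=\pi^{-2D}$, whose integral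
   over two copies of the ball is the squared mean. *)
have QW : Q + k%:E * W = (e ^+ 2)%:E.
  rewrite QE (integral_npt_pairs HXi)//.
  transitivity (\int[mu_CD n.+1]_x \int[mu_CD n.+1]_y
     (k%:E * (ind (csq x < S)%R * ind (csq y < S)%R)) : \bar R).
    rewrite /W -ge0_integralZl; [|exact: measurableT|sideT|sideT|sideT].
    rewrite -ge0_integralD; [|exact: measurableT|sideT|sideT|sideT|sideT].
    apply: eq_integral => x _.
    rewrite -ge0_integralZl; [|exact: measurableT|sideT|sideT|sideT].
    rewrite -ge0_integralD; [|exact: measurableT|sideT|sideT|sideT|sideT].
    apply: eq_integral => y _.
    rewrite !in_Lam /ind /pair_density -/k -!EFinM -EFinD; congr EFin; ring.
  transitivity (\int[mu_CD n.+1]_x (k%:E * vol * ind (csq x < S)%R)).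
    apply: eq_integral => x _.
    transitivity (\int[mu_CD n.+1]_y ((k%:E * ind (csq x < S)%R) * ind (csq y < S)%R)).
      by apply: eq_integral => y _; rewrite muleA.
    rewrite ge0_integralZl; [|exact: measurableT|sideT|sideT|sideT].
    by rewrite -/vol muleAC.
  have vol0 : 0 <= vol by rewrite /vol; sideT.
  rewrite ge0_integralZl; [|exact: measurableT|sideT|sideT|sideT].
  rewrite -/vol volE -!EFinM; congr EFin.
  rewrite /k /e exprVn exprM -/S; move: (piX_neq0 n.+1); set p := (pi ^+ n.+1)%R => p0.
  have f0 : (n.+1`!%:R : R) != 0%R by rewrite pnatr_eq0 -lt0n fact_gt0.
  field.
  by rewrite f0 p0.
set X := \intR_ t _.
have W00 : 0 <= W by rewrite /W; sideT.
have X00 : 0 <= X.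
  have g0 := @gamma_tail_ge0 R n; have s0 := @slice_vol_ge0 R n.
  by rewrite /X; sideT.
(* The overlap identity times $k$: its left side becomes the mean, and the constant becomes
   $2\pi^{2n+1}\pi^{-2n-2}=2/\pi$. *)
have aX : k%:E * W + (2 / pi)%:E * X = e%:E.
  have := congr1 (fun z => k%:E * z) (ball_overlap_identity n S).
  rewrite -/vol -/W volE -!EFinM => h.
  transitivity (k%:E * (W + (pi ^+ n.+1 * pi ^+ n * 2)%:E * X)).
    rewrite (@ge0_muleDr _ k%:E W ((pi ^+ n.+1 * pi ^+ n * 2)%:E * X)); [|exact: W00|
      by apply: mule_ge0 X00; rewrite lee_fin !mulr_ge0// exprn_ge0// pi_ge0].
    congr (_ + _); rewrite muleA -EFinM; congr (_%:E * _).
    rewrite /k (exprS pi n); move: (piX_neq0 n) (piX_neq0 1); rewrite expr1.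
    move: (pi ^+ n)%R => p; move: (@pi R) => q p0 q0; field.
    by rewrite p0 q0.
  rewrite -h; congr EFin; rewrite /k /e exprM -/S.
  move: (piX_neq0 n.+1); set p := (pi ^+ n.+1)%R => p0.
  have f0 : (n.+1`!%:R : R) != 0%R by rewrite pnatr_eq0 -lt0n fact_gt0.
  field.
  by rewrite f0 p0.
have W0 : 0 <= k%:E * W by rewrite mule_ge0.
have X0 : 0 <= (2 / pi)%:E * X by rewrite mule_ge0// lee_fin divr_ge0// pi_ge0.
have Q0 : 0 <= Q by rewrite /Q; apply: integral_ge0 => w _; rewrite lee_fin.
have I0 : 0 <= I by rewrite /I; apply: integral_ge0 => w _; rewrite lee_fin sqr_ge0.
have [q [a [Qq Wa qa]]] := adde_eq_EFin Q0 W0 QW.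
have [a' [x [Wa' Xx ax]]] := adde_eq_EFin W0 X0 aX.
have aa : a' = a by apply: EFin_inj; rewrite -Wa -Wa'.
move: IQ; rewrite Qq -!EFinD => IQ.
have ee0 : 0 <= (2 * e * e)%:E.
  by rewrite lee_fin; apply: mulr_ge0 => //; exact: mulr_ge0.
have [i [j [Ii jE ij]]] := adde_eq_EFin I0 ee0 IQ.
have je : (j = 2 * e * e)%R by apply: EFin_inj; rewrite -jE.
(* From $q=e^2-a$ and $e=a+x$ the variance is $q+e+e^2-2e^2=e-a=x$. *)
rewrite Ii Xx /=; congr EFin.
have -> : (i = q + e + e ^+ 2 - j)%R by rewrite -ij addrK.
have -> : (q = e ^+ 2 - a)%R by rewrite -qa addrK.
by rewrite je -ax aa; ring.
Qed.

End CountMoments.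

(** * Asymptotics *)

Section HalfIntegerTaylor.
Context {R : realType}.
Implicit Types (b x : R) (k N : nat).

(** The coefficient $(-1)^k\binom{b}{k}$ of $x^k$ in $(1-x)^b$. *)
Definition bin_coef b k : R := (\prod_(0 <= i < k) (i%:R - b)) / k`!%:R.

Definition bin_poly b N : {poly R} := \poly_(k < N) bin_coef b k.

Lemma bin_coef_deriv b k : bin_coef b k.+1 * k.+1%:R = - b * bin_coef (b - 1) k.
Proof.
rewrite /bin_coef big_nat_recl// mulr0n sub0r factS natrM invfM.
rewrite (eq_bigr (fun i => i%:R - (b - 1))); last first.
  by move=> i _; rewrite -natr1; ring.
have : (k.+1%:R : R) != 0 by rewrite pnatr_eq0.
have : (k`!%:R : R) != 0 by rewrite pnatr_eq0 -lt0n fact_gt0.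
move: (k.+1%:R : R) (k`!%:R : R) (\prod_(_ <= i < _) _) => u v w v0 u0.
by field; rewrite u0 v0.
Qed.

Lemma bin_poly_deriv b N : (bin_poly b N.+1)^`() = - b *: bin_poly (b - 1) N.
Proof.
apply/polyP => k; rewrite coef_deriv coefZ !coef_poly ltnS.
case: ifP => kN; last by rewrite mul0rn mulr0.
by rewrite -mulr_natr bin_coef_deriv.
Qed.

Definition one_sub_pow b x : R := expR (b * ln (1 - x)).

Lemma is_derive_one_sub_pow b x : x < 1 ->
  is_derive x 1 (one_sub_pow b) (- b * one_sub_pow (b - 1) x).
Proof.
move=> x1; have y0 : 0 < 1 - x by rewrite subr_gt0.
have d1 : is_derive x 1 (fun z : R => 1 - z) (-1).
  have := is_deriveB (is_derive_cst (1 : R) x 1) (is_derive_id x 1).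
  by rewrite sub0r.
have d2 : is_derive x 1 (fun z : R => ln (1 - z)) ((1 - x)^-1 * -1).
  exact: (@is_derive1_comp R (@ln R) (fun z : R => 1 - z) x _ _ (is_derive1_ln y0) d1).
have d3 : is_derive x 1 (fun z : R => b * ln (1 - z)) (b * ((1 - x)^-1 * -1)).
  exact: (is_deriveZ b d2).
have d4 := @is_derive1_comp R expR (fun z : R => b * ln (1 - z)) x _ _
  (is_derive_expR (b * ln (1 - x))) d3.
apply: is_derive_eq d4 _.
rewrite /one_sub_pow mulrBl mul1r expRD expRN lnK ?posrE//.
by ring.
Qed.

(** Induction on [N] for all [b] at once: the remainder vanishes at 0, and its derivative is $-b$
    times the remainder of lower order for $b-1$. Staying below $1/2$ bounds $(1-x)^b$ by $2^{|b|}$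
    even when the exponent has become negative. *)
Lemma one_sub_pow_taylor b N : exists2 C : R, 0 <= C &
  forall x, 0 <= x -> x <= 2^-1 ->
  `|one_sub_pow b x - (bin_poly b N).[x]| <= C * x ^+ N.
Proof.
elim: N b => [|N IH] b.
  exists (expR (`|b| * ln 2)); first exact: expR_ge0.
  move=> x x0 x2; rewrite /bin_poly poly_def big_ord0 horner0 subr0 mulr1.
  rewrite ger0_norm ?expR_ge0// ler_expR.
  have y0 : 0 < 1 - x by lra.
  have l1 : ln (1 - x) <= 0 by apply: ln_le0; lra.
  have l2 : - ln 2 <= ln (1 - x).
    rewrite -lnV ?posrE//; rewrite ler_ln ?posrE//; lra.
  rewrite (le_trans (ler_norm _))// normrM ler_wpM2l// ler0_norm//; lra.
have [C C0 hC] := IH (b - 1).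
exists (`|b| * C); first by rewrite mulr_ge0.
move=> x x0 x2.
pose g z := one_sub_pow b z - (bin_poly b N.+1).[z].
pose dg z := - b * (one_sub_pow (b - 1) z - (bin_poly (b - 1) N).[z]).
have dgP (z : R) : z < 1 -> is_derive z (1 : R) g (dg z).
  move=> z1; have h := is_deriveB (is_derive_one_sub_pow b z1) (is_derive_poly (bin_poly b N.+1) z).
  apply: is_derive_eq h _.
  by rewrite bin_poly_deriv hornerZ /dg; ring.
have g0 : g 0 = 0.
  rewrite /g /one_sub_pow subr0 ln1 mulr0 expR0 horner_coef0 coef_poly /=.
  by rewrite /bin_coef big_geq// fact0 divr1 subrr.
have cg : {within `[0, x], continuous g}.
  apply: derivable_within_continuous => z; rewrite in_itv/= => /andP[_ zx].
  by have [] := dgP z (ltac:(lra)).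
have dgx (z : R) : z \in `]0, x[ -> is_derive z (1 : R) g (dg z).
  by rewrite in_itv/= => /andP[_ zx]; apply: dgP; lra.
have [z] := MVT_segment x0 dgx cg.
rewrite in_itv/= => /andP[z0 zx].
rewrite g0 !subr0 -/(g x) => ->.
rewrite /dg !normrM normrN (ger0_norm x0) -!mulrA ler_wpM2l//.
have z2 : z <= 2^-1 by lra.
rewrite exprSr mulrA ler_wpM2r//.
rewrite (le_trans (hC z z0 z2))// ler_wpM2l// lerXn2r// nnegrE.
Qed.

(** This is $(1-x)_+^{n+1/2}$: the truncation is done by [Num.sqrt], which is 0 at negative
    arguments. *)
Definition half_pow (n : nat) x : R := (1 - x) ^+ n * Num.sqrt (1 - x).

Lemma half_pow_ge0 n x : 0 <= half_pow n x.
Proof.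
rewrite /half_pow; have [h|h] := leP (1 - x) 0; first by rewrite ler0_sqrtr ?mulr0.
by rewrite mulr_ge0// exprn_ge0// ltW.
Qed.

Lemma half_pow_le1 n x : 0 <= x -> half_pow n x <= 1.
Proof.
move=> x0; rewrite /half_pow; have [h|h] := leP (1 - x) 0.
  by rewrite ler0_sqrtr ?mulr0// ler01.
rewrite mulr_ile1 ?exprn_ge0 ?sqrtr_ge0 ?(ltW h)//.
- by rewrite exprn_ile1// ?(ltW h)//; lra.
- by rewrite -[X in _ <= X]sqrtr1 ler_wsqrtr//; lra.
Qed.

Lemma half_powE n x : x < 1 -> half_pow n x = one_sub_pow (n%:R + 2^-1) x.
Proof.
move=> x1; have y0 : 0 < 1 - x by rewrite subr_gt0.
rewrite /half_pow /one_sub_pow mulrDl expRD; congr (_ * _).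
  by rewrite expRM_natl lnK.
have e0 := expR_ge0 (2^-1 * ln (1 - x)).
by rewrite -[RHS]ger0_norm// -sqrtr_sqr -expRM_natl mulrA mulfV ?mul1r ?lnK.
Qed.

(** Beyond $1/2$ nothing is expanded: since $2x\ge 1$, the function and each monomial of degree
    below [N] are at most $(2x)^N$. Hence the summand with $2^N$ in the constant. *)
Lemma half_pow_taylor n N : exists2 C : R, 0 <= C &
  forall x, 0 <= x ->
  `|half_pow n x - \sum_(k < N) bin_coef (n%:R + 2^-1) k * x ^+ k| <= C * x ^+ N.
Proof.
set b := n%:R + 2^-1.
have [C C0 hC] := one_sub_pow_taylor b N.
pose M := \sum_(k < N) `|bin_coef b k|.
have M0 : 0 <= M by apply: sumr_ge0.
exists (C + (1 + M) * 2 ^+ N).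
  by rewrite addr_ge0// mulr_ge0// addr_ge0.
move=> x x0.
have [x2|x2] := leP x 2^-1.
  rewrite half_powE; last by lra.
  have := hC x x0 x2; rewrite horner_poly => /le_trans; apply.
  by rewrite ler_wpM2r ?exprn_ge0// lerDl mulr_ge0// addr_ge0.
apply: le_trans (ler_normB _ _) _.
have x21 : 1 <= 2 * x by lra.
have h1 : `|half_pow n x| <= (2 * x) ^+ N.
  rewrite ger0_norm ?half_pow_ge0// (le_trans (half_pow_le1 _ x0))//.
  exact: exprn_ege1.
have h2 : `|\sum_(k < N) bin_coef b k * x ^+ k| <= M * (2 * x) ^+ N.
  apply: le_trans (ler_norm_sum _ _ _) _.
  rewrite /M mulr_suml; apply: ler_sum => k _.
  rewrite normrM ler_wpM2l// ger0_norm ?exprn_ge0//.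
  apply: (@le_trans _ _ ((2 * x) ^+ k)).
    by rewrite lerXn2r ?nnegrE//; lra.
  by apply: ler_weXn2l => //; exact: ltnW.
apply: le_trans (lerD h1 h2) _.
rewrite exprMn -{1}[2 ^+ N * x ^+ N]mul1r -mulrDl mulrA ler_wpM2r ?exprn_ge0//.
by rewrite lerDr.
Qed.

End HalfIntegerTaylor.

(** Positivity of [r] rules out the convention that 0 times infinity is 0. Applied to
    [slice_vol_gamma_half], it shows that both factors are finite. *)
Lemma mule_eq_EFin (R : realType) (x y : \bar R) (r : R) :
  (0 <= x)%E -> (0 <= y)%E -> 0 < r -> (x * y = r%:E)%E ->
  exists a b, [/\ x = a%:E, y = b%:E & a * b = r].
Proof.
case: x y => [a| |] [b| |] // a0 b0 r0.
- by rewrite -EFinM => -[<-]; exists a, b.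
- move: a0; rewrite lee_fin le_eqVlt => /orP[/eqP <-|a0].
    by rewrite mul0e => -[r0']; move: r0; rewrite -r0' ltxx.
  by rewrite gt0_muley.
- move: b0; rewrite lee_fin le_eqVlt => /orP[/eqP <-|b0].
    by rewrite mule0 => -[r0']; move: r0; rewrite -r0' ltxx.
  by rewrite gt0_mulye.
Qed.

(** * Moments of the Gamma tail and expansion of the variance integral *)

Section GammaTailMoments.
Context {R : realType}.
Variable n : nat.

Lemma slice_const_ex : exists c g : R,
  [/\ slice_vol n 1 = c%:E, @gamma_half R n = g%:E & c * g = Num.sqrt pi].
Proof.
apply: mule_eq_EFin (slice_vol_gamma_half n).
- exact: slice_vol_ge0.
- exact: gamma_half_ge0.
- by rewrite sqrtr_gt0 pi_gt0.
Qed.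

Definition slice_const : R := fine (slice_vol n 1).
Definition gamma_const : R := fine (@gamma_half R n).

Lemma slice_constE : slice_vol n 1 = slice_const%:E.
Proof. by have [c [g [h _ _]]] := slice_const_ex; rewrite /slice_const h. Qed.

Lemma gamma_constE : @gamma_half R n = gamma_const%:E.
Proof. by have [c [g [_ h _]]] := slice_const_ex; rewrite /gamma_const h. Qed.

Lemma slice_gamma_const : slice_const * gamma_const = Num.sqrt pi.
Proof.
by have [c [g [h1 h2 h3]]] := slice_const_ex; rewrite /slice_const /gamma_const h1 h2.
Qed.

Lemma gamma_half_add k : @gamma_half R (n + k) =
  (gamma_const * \prod_(0 <= i < k) ((n + i)%:R + 3 / 2))%:E.
Proof.
elim: k => [|k IH]; first by rewrite addn0 big_geq// mulr1 gamma_constE.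
rewrite addnS gamma_halfS IH -EFinM big_nat_recr//=; congr EFin.
by ring.
Qed.

(** This is $\Gamma(n+k+3/2)/(n!\,2^{2k+1}(2k+1))$, with the Gamma value written as a multiple of
    $\Gamma(n+3/2)$ so that this unknown can cancel later. *)
Definition moment k : R :=
  gamma_const * \prod_(0 <= i < k) ((n + i)%:R + 3 / 2) /
  (n`!%:R * 2 ^+ (2 * k).+1 * (2 * k).+1%:R).

Local Open Scope ereal_scope.

(** After the exchange, this is the mean of $(\sqrt q/2)^{2k+1}/(2k+1)$ under the Gamma law of
    parameter $n+1$. *)
Lemma gamma_tail_moment k :
  \intR_ t (ind (0 < t)%R * ((t ^+ (2 * k))%:E * gamma_tail n t)) = (moment k)%:E.
Proof.
have p2 (t : R) : (0 <= t ^+ (2 * k))%R by rewrite exprM exprn_ge0// sqr_ge0.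
rewrite (gamma_tail_swap n (f := fun t => (t ^+ (2 * k))%:E)); [|sideT|by move=> t; rewrite lee_fin].
transitivity (simplex_int n.+1 (fun q : R => ((expR (- q) * ((Num.sqrt q / 2) ^+ (2 * k).+1 / (2 * k).+1%:R)))%:E)).
  apply: eq_simplex_int => q; rewrite intR_pow -?EFinM//.
rewrite simplex_int_density; [|sideT|by move=> q; sideT; rewrite divr_ge0// sqrtr_ge0].
rewrite /moment.
set C := (n`!%:R * 2 ^+ (2 * k).+1 * (2 * k).+1%:R)%R.
have C0 : (0 < C)%R.
  by rewrite /C !mulr_gt0 ?exprn_gt0// ltr0n fact_gt0.
transitivity ((C^-1)%:E * gamma_half (n + k)); last first.
  by rewrite gamma_half_add -EFinM mulrC.
rewrite /gamma_half -intR_Zl; [|by rewrite lee_fin invr_ge0 ltW|sideT|sideT].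
apply: eq_intR => q; rewrite [RHS]muleCA /ind.
case: (ltP 0%R q) => q0; last by rewrite !mul0e.
rewrite !mul1e -!EFinM; congr EFin.
rewrite /C exprMn exprS exprM sqr_sqrtr ?ltW// exprD exprVn.
have f0 : (n`!%:R : R) != 0%R by rewrite pnatr_eq0 -lt0n fact_gt0.
have k0 : ((2 * k).+1%:R : R) != 0%R by rewrite pnatr_eq0.
have t0 : (2 ^+ (2 * k).+1 : R)%R != 0%R by rewrite expf_neq0.
move: f0 k0 t0; move: (n`!%:R)%R ((2 * k).+1%:R)%R (2 ^+ (2 * k).+1)%R => x y z x0 y0 z0.
by field; rewrite x0 y0 z0.
Qed.

Lemma gamma_tail_le1 (t : R) : gamma_tail n t <= 1.
Proof.
have <- : simplex_int n.+1 (fun w => (expR (- (0 + w)))%:E) = 1 :> \bar R.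
  by rewrite simplex_int_expR oppr0 expR0.
rewrite simplex_int_density; [|sideT|sideT].
rewrite /gamma_tail; apply: ge0_le_integral => //.
- by move=> q _; sideT.
- by sideT.
- by sideT.
move=> q _; rewrite add0r /ind; case: (ltP 0%R q) => q0; last by rewrite !mul0e.
rewrite !mul1e -!EFinM lee_fin.
have h : (0 <= q ^+ n / n`!%:R * expR (- q))%R.
  by rewrite mulr_ge0 ?expR_ge0// divr_ge0// exprn_ge0// ltW.
by case: (_ < _)%R => /=; rewrite ?mul0r ?mul1r ?mulr0 ?mulr1 ?lexx// mulr_ge0// expR_ge0.
Qed.

(** The tail as a real function on $t>0$: the expansion involves signed differences, hence real
    integrals instead of nonnegative ones in [\bar R]. *)
Definition weight (t : R) : R := (0 < t)%R%:R * fine (gamma_tail n t).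

Lemma weightE t : (weight t)%:E = ind (0 < t)%R * gamma_tail n t.
Proof.
rewrite /weight EFinM fineK// ge0_fin_numE ?gamma_tail_ge0//.
by rewrite (le_lt_trans (gamma_tail_le1 t))// ltry.
Qed.

Lemma weight_ge0 t : (0 <= weight t)%R.
Proof. by rewrite mulr_ge0// fine_ge0// gamma_tail_ge0. Qed.

Lemma measurable_weight : measurable_fun setT weight.
Proof.
apply/measurable_EFinP; rewrite (_ : _ \o _ = fun t => ind (0 < t)%R * gamma_tail n t).
  by have := @measurable_gamma_tail R n => ?; measT.
by apply/funext => t; rewrite /= weightE.
Qed.

Let mu := @lebesgue_measure R.
Let mw := measurable_weight.

Lemma integral_weight_moment k :
  \int[mu]_t (t ^+ (2 * k) * weight t)%:E = (moment k)%:E.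
Proof.
rewrite -gamma_tail_moment; apply: eq_intR => t.
by rewrite EFinM weightE muleCA.
Qed.

Lemma integrable_weight_moment k :
  mu.-integrable setT (fun t => (t ^+ (2 * k) * weight t)%:E).
Proof.
apply/integrableP; split; first by measT.
under eq_integral => t _.
  rewrite gee0_abs; first over.
  by rewrite lee_fin mulr_ge0 ?weight_ge0// exprM exprn_ge0// sqr_ge0.
by rewrite integral_weight_moment ltry.
Qed.

Lemma moment_sum N (a : nat -> R) :
  mu.-integrable setT (EFin \o (fun t => \sum_(k < N) a k * (t ^+ (2 * k) * weight t)))%R /\
  (\int[mu]_t (\sum_(k < N) a k * (t ^+ (2 * k) * weight t)) = \sum_(k < N) a k * moment k)%R.
Proof.
elim: N => [|N [IH1 IH2]].
  split.
    rewrite (_ : _ \o _ = cst 0); first exact: integrable0.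
    by apply/funext => t /=; rewrite big_ord0.
  under eq_Rintegral do rewrite big_ord0.
  by rewrite big_ord0 /Rintegral integral0.
have h : mu.-integrable setT (EFin \o (fun t => a N * (t ^+ (2 * N) * weight t)))%R.
  rewrite (_ : _ \o _ = fun t => (a N)%:E * (t ^+ (2 * N) * weight t)%:E).
    by apply: integrableZl => //; exact: integrable_weight_moment.
  by apply/funext => t /=; rewrite EFinM.
split.
  rewrite (_ : _ \o _ = (EFin \o (fun t => \sum_(k < N) a k * (t ^+ (2 * k) * weight t))%R) \+
    (EFin \o (fun t => a N * (t ^+ (2 * N) * weight t)))%R).
    by apply: integrableD.
  by apply/funext => t /=; rewrite big_ord_recr/= EFinD.
under eq_Rintegral do rewrite big_ord_recr /=.
rewrite RintegralD// IH2 big_ord_recr /=; congr (_ + _)%R.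
rewrite RintegralZl//; last exact: integrable_weight_moment.
by rewrite /Rintegral integral_weight_moment.
Qed.

Lemma moment_ge0 k : (0 <= moment k)%R.
Proof.
rewrite -lee_fin -integral_weight_moment; apply: integral_ge0 => t _.
by rewrite lee_fin mulr_ge0 ?weight_ge0// exprM exprn_ge0// sqr_ge0.
Qed.

Definition scaled_profile (r : R) : R :=
  (\int[mu]_t (half_pow n (t ^+ 2 / r ^+ 2) * weight t))%R.

Let measurable_profile (r : R) :
  measurable_fun setT (fun t : R => half_pow n (t ^+ 2 / r ^+ 2) * weight t)%R.
Proof. by rewrite /half_pow; measT. Qed.

Let profile_le (r t : R) : (half_pow n (t ^+ 2 / r ^+ 2) * weight t <= weight t)%R.
Proof.
by rewrite ler_piMl ?weight_ge0// half_pow_le1// divr_ge0 ?sqr_ge0.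
Qed.

Lemma integrable_profile (r : R) :
  mu.-integrable setT (EFin \o (fun t => half_pow n (t ^+ 2 / r ^+ 2) * weight t))%R.
Proof.
apply: (le_integrable measurableT _ _ (integrable_weight_moment 0)).
  by apply/measurable_EFinP; exact: measurable_profile.
move=> t _; rewrite lee_fin muln0 expr0 mul1r.
by rewrite (ger0_norm (weight_ge0 t)) ger0_norm ?profile_le// mulr_ge0 ?weight_ge0 ?half_pow_ge0.
Qed.

(** Homogeneity of [slice_vol] applied to $r^2-t^2=r^2(1-t^2/r^2)$ extracts $r^{2n+1}$; the
    remaining integral depends on [r] only through $t^2/r^2$. *)
Lemma overlap_profile (r : R) : (0 < r)%R ->
  \intR_ t (ind (0 < t)%R * (slice_vol n (r ^+ 2 - t ^+ 2)%R * gamma_tail n t)) =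
  (slice_const * r ^+ (2 * n).+1 * scaled_profile r)%:E.
Proof.
move=> r0.
have w0 := weight_ge0; have h0 := @half_pow_ge0 R n.
have -> : (slice_const * r ^+ (2 * n).+1 * scaled_profile r)%:E =
    (slice_const * r ^+ (2 * n).+1)%:E *
    \int[mu]_t (half_pow n (t ^+ 2 / r ^+ 2) * weight t)%:E.
  rewrite EFinM /scaled_profile /Rintegral fineK//.
  exact: (integrable_fin_num measurableT (integrable_profile r)).
have c0 : (0 <= slice_const)%R by rewrite /slice_const fine_ge0// slice_vol_ge0.
rewrite -intR_Zl; last 3 first.
- by rewrite lee_fin mulr_ge0// exprn_ge0// ltW.
- by apply/measurable_EFinP; exact: measurable_profile.
- by move=> t; rewrite lee_fin mulr_ge0.
apply: eq_intR => t.
have r2 : (r ^+ 2 - t ^+ 2 = r ^+ 2 * (1 - t ^+ 2 / r ^+ 2))%R.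
  by field; rewrite gt_eqF.
have -> : slice_vol n (r ^+ 2 - t ^+ 2) =
    (slice_const * r ^+ (2 * n).+1)%:E * (half_pow n (t ^+ 2 / r ^+ 2))%:E.
  rewrite slice_vol_scale slice_constE -!EFinM /half_pow; congr EFin.
  rewrite r2 exprMn sqrtrM ?sqr_ge0// sqrtr_sqr gtr0_norm// (exprS r (2 * n)) (exprM r).
  by ring.
by rewrite (EFinM (half_pow n _) (weight t)) weightE; mule_ac.
Qed.

(** The Taylor bound at $x=t^2/r^2$ also covers $t>r$, so it is integrated against [weight] without
    any cut-off, and the estimate holds for every $r>0$. *)
Lemma profile_expansion N : exists2 C : R, (0 <= C)%R & forall r, (0 < r)%R ->
  (`| scaled_profile r - \sum_(k < N) bin_coef (n%:R + 2^-1) k * r ^- (2 * k) * moment k |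
   <= C * r ^- (2 * N))%R.
Proof.
have [C C0 hC] := @half_pow_taylor R n N.
exists (C * moment N)%R; first by rewrite mulr_ge0// moment_ge0.
move=> r r0.
pose a k : R := (bin_coef (n%:R + 2^-1) k * r ^- (2 * k))%R.
have [iS <-] := moment_sum N a.
have iP := integrable_profile r.
rewrite /scaled_profile -RintegralB//.
have iB : mu.-integrable setT (EFin \o (fun t => half_pow n (t ^+ 2 / r ^+ 2) * weight t -
    \sum_(k < N) a k * (t ^+ (2 * k) * weight t)))%R.
  rewrite (_ : _ \o _ = (EFin \o (fun t => half_pow n (t ^+ 2 / r ^+ 2) * weight t)%R) \-
    (EFin \o (fun t => \sum_(k < N) a k * (t ^+ (2 * k) * weight t))%R)).
    exact: integrableB.
  by apply/funext => t /=; rewrite EFinB.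
apply: le_trans (le_normr_Rintegral measurableT iB) _.
have -> : (C * moment N * r ^- (2 * N))%R =
    (\int[mu]_t ((C * r ^- (2 * N)) * (t ^+ (2 * N) * weight t)))%R.
  rewrite RintegralZl//; last exact: integrable_weight_moment.
  by rewrite /Rintegral integral_weight_moment /= mulrAC.
apply: le_Rintegral => //.
- by have := integrable_norm iB.
- rewrite (_ : _ \o _ = fun t => (C * r ^- (2 * N))%:E * (t ^+ (2 * N) * weight t)%:E).
    by apply: integrableZl => //; exact: integrable_weight_moment.
  by apply/funext => t /=; rewrite EFinM.
move=> t _.
have x0 : (0 <= t ^+ 2 / r ^+ 2)%R by rewrite divr_ge0// sqr_ge0.
have := hC _ x0; set s := (\sum_(k < N) _)%R => hs.
have -> : (\sum_(k < N) a k * (t ^+ (2 * k) * weight t) = s * weight t)%R.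
  rewrite /s mulr_suml; apply: eq_bigr => k _.
  by rewrite /a exprMn exprVn -!exprM mulrA; ring.
rewrite -mulrBl normrM (ger0_norm (weight_ge0 t)) mulrA ler_wpM2r ?weight_ge0//.
by rewrite (le_trans hs)// exprMn exprVn -!exprM -mulrA (mulrC (t ^+ _)%R).
Qed.

End GammaTailMoments.

(** * Expansion of the ratio of variance to mean *)

Section VarianceAsymptotics.
Context {R : realType}.

(** Factor by factor, with $D=n+1$: $4(i-n-1/2)(n+i+3/2)=(2i+1)^2-4D^2$, which is minus the factor
    of $\alpha_k(D)$ with $\ell=i+1$. *)
Lemma bin_coef_half_moment n k :
  bin_coef (n%:R + 2^-1) k * \prod_(0 <= i < k) ((n + i)%:R + 3 / 2) =
  (-1) ^+ k * alpha R k n.+1 / (k`!%:R * 2 ^+ (2 * k)) :> R.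
Proof.
have f0 : (k`!%:R : R) != 0 by rewrite pnatr_eq0 -lt0n fact_gt0.
have p0 : (2 ^+ (2 * k) : R) != 0 by rewrite expf_neq0.
have h : (\prod_(0 <= i < k) (i%:R - (n%:R + 2^-1))) *
    \prod_(0 <= i < k) ((n + i)%:R + 3 / 2) * 2 ^+ (2 * k) = (-1) ^+ k * alpha R k n.+1.
  rewrite /alpha big_add1 /=.
  elim: k {f0 p0} => [|k IH]; first by rewrite !big_geq// muln0 !expr0 !mulr1.
  rewrite !big_nat_recr//= (mulnS 2 k) exprD (exprS (-1)).
  rewrite (natrD _ n k) (natrD _ 2 (2 * k)) (natrM _ 2 k).
  move: IH; move: (\prod_(_ <= _ < _) _) (\prod_(_ <= _ < _) _) (\prod_(_ <= _ < _) _).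
  rewrite -[n.+1%:R]natr1; move: (2 ^+ (2 * k)) ((-1) ^+ k) (n%:R : R) (k%:R : R) => p e m j u v w IH.
  transitivity (w * v * p * (2 ^+ 2 * (j - (m + 2^-1)) * (m + j + 3 / 2))); first by ring.
  by rewrite IH; field.
rewrite -h /bin_coef; move: f0 p0.
move: (k`!%:R : R) (2 ^+ (2 * k) : R) (\prod_(_ <= _ < _) _) (\prod_(_ <= _ < _) _) => x y u v x0 y0.
by field; rewrite x0 y0.
Qed.

(** [gamma_const] cancels against [slice_const] up to $\sqrt\pi$, the factorials leave $n+1=D$, and
    $2\cdot2^{-2k-1}\cdot2^{-2k}=2^{-4k}$. *)
Lemma expansion_coefE n k :
  2 / pi * slice_const n * n.+1`!%:R * (bin_coef (n%:R + 2^-1) k * moment n k) =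
  n.+1%:R / Num.sqrt pi * expansion_coef R k n.+1 :> R.
Proof.
have sc := @slice_gamma_const R n.
have s0 : Num.sqrt pi != 0 :> R by rewrite gt_eqF// sqrtr_gt0 pi_gt0.
have ps : pi = Num.sqrt pi ^+ 2 :> R by rewrite sqr_sqrtr// pi_ge0.
have f0 : (n`!%:R : R) != 0 by rewrite pnatr_eq0 -lt0n fact_gt0.
have k0 : (k`!%:R : R) != 0 by rewrite pnatr_eq0 -lt0n fact_gt0.
have q0 : ((2 * k).+1%:R : R) != 0 by rewrite pnatr_eq0.
have p0 : (2 ^+ (2 * k) : R) != 0 by rewrite expf_neq0.
have -> : bin_coef (n%:R + 2^-1) k * moment n k =
    gamma_const n * ((-1) ^+ k * alpha R k n.+1 / (k`!%:R * 2 ^+ (2 * k))) /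
    (n`!%:R * 2 ^+ (2 * k).+1 * (2 * k).+1%:R) :> R.
  by rewrite -bin_coef_half_moment /moment; ring.
rewrite /expansion_coef factS natrM addn1 (_ : 4 * k = 2 * k + 2 * k)%N; last first.
  by rewrite -mulnDl.
rewrite exprD exprS [X in 2 / X]ps {ps}.
have -> : slice_const n = Num.sqrt pi / gamma_const n :> R.
  rewrite -sc mulfK//; apply/eqP => g0; move: sc; rewrite g0 mulr0 => s1.
  by move: s0; rewrite -s1 eqxx.
have g0 : gamma_const n != 0 :> R.
  apply/eqP => g0; move: sc; rewrite g0 mulr0 => s1.
  by move: s0; rewrite -s1 eqxx.
move: s0 f0 k0 q0 p0 g0 {sc}.
move: (Num.sqrt pi : R) (n`!%:R : R) (k`!%:R : R) ((2 * k).+1%:R : R) (2 ^+ (2 * k) : R) (gamma_const n : R).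
move: ((-1) ^+ k : R) (alpha R k n.+1) (n.+1%:R : R) => e a m s f h q p g s0 f0 h0 q0 p0 g0.
by field; rewrite s0 f0 h0 q0 p0 g0.
Qed.

Variables (n : nat) (d : measure_display) (Omega : measurableType d).
Variables (P : probability Omega R) (Xi : Omega -> set (CD R n.+1)).
Hypothesis HXi : is_DPP P Xi (@KH R n.+1).

Let E r := mean_count P Xi (ballC n.+1 r).
Let V r := var_count P Xi (ballC n.+1 r).

Lemma mean_ball_gt0 r : 0 < r -> 0 < E r.
Proof.
by move=> r0; rewrite /E (mean_count_ball HXi r0) divr_gt0 ?exprn_gt0// ltr0n fact_gt0.
Qed.

Lemma var_mean_ratio r : 0 < r ->
  V r / E r = 2 / pi * slice_const n * n.+1`!%:R * r^-1 * scaled_profile n r.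
Proof.
move=> r0.
have -> : V r = 2 / pi * (slice_const n * r ^+ (2 * n).+1 * scaled_profile n r).
  by apply: EFin_inj; rewrite /V (var_count_ball HXi r0) overlap_profile// -EFinM.
rewrite /E (mean_count_ball HXi r0) (_ : 2 * n.+1 = (2 * n).+2)%N; last by rewrite mulnS.
rewrite (exprS r (2 * n).+1) !(exprS r (2 * n)).
have r1 : r != 0 by rewrite gt_eqF.
have p0 : r ^+ (2 * n) != 0 by rewrite expf_neq0.
have f0 : (n.+1`!%:R : R) != 0 by rewrite pnatr_eq0 -lt0n fact_gt0.
have pi0 : (pi : R) != 0 by rewrite gt_eqF// pi_gt0.
move: r1 p0 f0 pi0.
move: (scaled_profile n r) (slice_const n : R) (r ^+ (2 * n)) (n.+1`!%:R : R) (pi : R).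
move=> a b x y z r1 x0 y0 z0.
by field; rewrite r1 x0 y0 z0.
Qed.

Lemma var_mean_expansion N : exists2 C : R, 0 <= C & forall r, 0 < r ->
  `|V r / E r - n.+1%:R / Num.sqrt pi * r^-1 *
      \sum_(0 <= k < N) expansion_coef R k n.+1 * r ^- (2 * k)| <= C * r ^- (2 * N).+1.
Proof.
have [C C0 hC] := @profile_expansion R n N.
pose c : R := 2 / pi * slice_const n * n.+1`!%:R.
exists (`|c| * C); first by rewrite mulr_ge0.
move=> r r0; rewrite (var_mean_ratio r0) -/c.
have -> : n.+1%:R / Num.sqrt pi * r^-1 *
    \sum_(0 <= k < N) expansion_coef R k n.+1 * r ^- (2 * k) =
    c * r^-1 * \sum_(k < N) bin_coef (n%:R + 2^-1) k * r ^- (2 * k) * moment n k.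
  rewrite big_mkord !mulr_sumr; apply: eq_bigr => k _.
  transitivity (n.+1%:R / Num.sqrt pi * expansion_coef R k n.+1 * (r^-1 * r ^- (2 * k))).
    by rewrite -[LHS]mulrA (mulrCA r^-1) [LHS]mulrA.
  rewrite -expansion_coefE -/c.
  move: c r^-1 (r ^- (2 * k)) (bin_coef _ _) (moment n k : R) => a b x y z.
  by ring.
rewrite -mulrBr normrM (_ : `|c * r^-1| = `|c| * r^-1); last first.
  by rewrite normf_div (gtr0_norm r0).
rewrite exprS invfM mulrACA ler_wpM2l ?hC//.
by rewrite divr_ge0// ltW.
Qed.

(** The expansion with one term, whose coefficient is 1. Its explicit rate serves both the limit and
    the two-sided bounds. *)
Lemma var_mean_bound : exists2 C : R, 0 <= C & forall r, 0 < r ->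
  `|r * (V r / E r) - n.+1%:R / Num.sqrt pi| <= C * r ^- 2.
Proof.
have [C C0 hC] := var_mean_expansion 1; exists C => // r r0.
have r1 : r != 0 by rewrite gt_eqF.
have := hC r r0; rewrite big_nat1 muln0 expr0 invr1 mulr1.
have -> : expansion_coef R 0 n.+1 = 1.
  by rewrite /expansion_coef /alpha big_geq// !muln0 fact0 !expr0 !mulr1 divr1.
rewrite mulr1 muln1 => h.
have -> : r * (V r / E r) - n.+1%:R / Num.sqrt pi =
    r * (V r / E r - n.+1%:R / Num.sqrt pi * r^-1).
  by rewrite mulrBr; congr (_ - _); rewrite mulrCA divff// mulr1.
rewrite normrM (gtr0_norm r0) (le_trans (ler_wpM2l (ltW r0) h))//.
by rewrite exprS invfM (mulrCA C) (mulrA r) divff// mul1r.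
Qed.

End VarianceAsymptotics.

Theorem theorem1p3 (R : realType) (D : nat) (D_gt0 : (0 < D)%N)
  (d : measure_display) (Omega : measurableType d) (P : probability Omega R)
  (Xi : Omega -> set (CD R D)) (HXi : is_DPP P Xi (@KH R D)) :
  let E := fun r : R => mean_count P Xi (ballC D r) in
  let V := fun r : R => var_count P Xi (ballC D r) in
  (* Class I hyperuniformity: Var ~ R^{2D-1} *)
  (exists c1 c2 : R, 0 < c1 /\ c1 < c2 /\
     exists M : R, forall r : R, M < r ->
       c1 * r ^+ (2 * D - 1) < V r /\ V r < c2 * r ^+ (2 * D - 1)) /\
  (* limit of R Var/E *)
  ((r * (V r / E r)) @[r --> +oo%R] --> D%:R / Num.sqrt pi) /\
  (* asymptotic expansion in the Poincare sense *)
  (forall N : nat, exists C M : R, forall r : R, M < r ->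
     `| V r / E r -
        D%:R / Num.sqrt pi * r^-1 *
          \sum_(0 <= k < N.+1) expansion_coef R k D * r ^- (2 * k) |
     <= C * r ^- (2 * N + 3)).
Proof.
case: D D_gt0 Xi HXi => // n _ Xi HXi E V.
have s0 : 0 < Num.sqrt pi :> R by rewrite sqrtr_gt0 pi_gt0.
pose L : R := n.+1%:R / Num.sqrt pi.
have L0 : 0 < L by rewrite divr_gt0.
have [C C0 hC] := var_mean_bound HXi.
have cv : (r * (V r / E r)) @[r --> +oo%R] --> L.
  apply/cvgrPdist_le => e e0; near=> r.
  have r1 : 1 <= r by near: r; exact: nbhs_pinfty_ge.
  (* Together with $r\ge1$ this gives $C\le er\le er^2$. *)
  have rC : C / e <= r by near: r; apply: nbhs_pinfty_ge; exact: num_real.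
  have r0 : 0 < r by rewrite (lt_le_trans _ r1).
  rewrite distrC (le_trans (hC r r0))// ler_pdivrMr ?exprn_gt0//.
  rewrite (le_trans (_ : C <= e * r))//; first by rewrite mulrC -ler_pdivrMr.
  by rewrite ler_wpM2l ?(ltW e0)// expr2 ler_peMl// ltW.
split; last split=> //; last first.
  (* A sum up to and including $k=N$ has $N+1$ terms, and its error exponent is $2(N+1)+1=2N+3$. *)
  move=> N; have [C' _ hC'] := var_mean_expansion HXi N.+1.
  exists C', 0 => r r0; rewrite (_ : 2 * N + 3 = (2 * N.+1).+1)%N; last first.
    by rewrite mulnS addnC.
  exact: hC'.
pose F : R := n.+1`!%:R.
have F0 : 0 < F by rewrite ltr0n fact_gt0.
exists (L / F / 2), (L / F * 2).
have LF0 : 0 < L / F by rewrite divr_gt0.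
split; first by rewrite divr_gt0.
split; first by lra.
(* Beyond this threshold $Cr^{-2}\le L/4$, so $r$ times the ratio lies in $[3L/4,5L/4]$, strictly
   inside $(L/2,2L)$; the mean $r^{2D}/D!$ then yields the two constants. *)
exists (1 + 4 * C / L) => r Mr.
have CL0 : 0 <= 4 * C / L by rewrite divr_ge0 ?mulr_ge0// ltW.
have r1 : 1 < r by lra.
have r0 : 0 < r by lra.
have VE : V r = r * (V r / E r) / F * r ^+ (2 * n.+1 - 1).
  have E0 := mean_ball_gt0 HXi r0.
  have -> : r * (V r / E r) / F * r ^+ (2 * n.+1 - 1) =
      V r / E r * (r ^+ (2 * n.+1) / F).
    have -> : (2 * n.+1 = (2 * n.+1 - 1).+1)%N by rewrite mulnS.
    rewrite subn1 /= exprS.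
    by move: (V r / E r) (r ^+ _) F^-1 => x y z; ring.
  by rewrite -(mean_count_ball HXi r0) divfK// gt_eqF.
have h : `|r * (V r / E r) - L| <= L / 4.
  rewrite (le_trans (hC r r0))// ler_pdivrMr ?exprn_gt0//.
  have h1 : 4 * C / L <= r by lra.
  rewrite -ler_pdivrMl ?divr_gt0// invf_div mulrAC (le_trans h1)//.
  by rewrite expr2 ler_peMl ?ltW.
move: h; rewrite ler_norml => /andP[h1 h2].
have rp : 0 < F^-1 * r ^+ (2 * n.+1 - 1) by rewrite mulr_gt0 ?invr_gt0 ?exprn_gt0.
have Lh : L / F / 2 * r ^+ (2 * n.+1 - 1) = L / 2 * (F^-1 * r ^+ (2 * n.+1 - 1)).
  by rewrite mulrA (mulrAC L).
rewrite VE Lh (mulrAC L _ 2) -(mulrA (L * 2)) -(mulrA (r * _)).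
by rewrite !ltr_pM2r//; split; lra.
Unshelve. all: by end_near.
Qed.
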